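(* Let $q$ be an odd prime power, fixed. Fix an integer $m\ge0$ and $c_0,\dots,c_m\in\mathbb F_q$ with $c_m\neq0$. For each $n$ let $\ell_n$ be an arbitrary $\mathbb F_q$-linear form in the coefficients $f_0,\dots,f_n$, and for $f=t^n+f_{n-1}t^{n-1}+\cdots+f_0$ (with $f_n=1$) put \[ Q_A(f)=\sum_{j=0}^m c_j\sum_{i=j}^n f_if_{i-j}+\ell_n(f). \] Then for every $\gamma\in\mathbb F_q$, \[ \#\{f\in\mathcal P(n):Q_A(f)=\gamma\}=\frac{\#\mathcal P(n)}{q}+O_A\bigl(q^{19n/20+o(n)}\bigr) \] as $n\to\infty$ with $q$ and $c_0,\dots,c_m$ fixed, uniformly in the choice of the linear forms $\ell_n$.
   Context: $\mathbb F_q$ is the finite field with $q$ elements, $\mathcal P(n)$ denotes the set of monic irreducible polynomials of degree $n$ in $\mathbb F_q[t]$. The implied constant in $O_A$ depends only on $q$ and $c_0,\dots,c_m$; $q^{o(n)}$ denotes a factor $q^{\varepsilon(n)n}$ with $\varepsilon(n)\to0$ as $n\to\infty$. *)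

(* Defs.v *)
From HB Require Import structures.
From mathcomp Require Import all_boot all_order all_algebra all_field.
From mathcomp Require Import boolp.
Set Implicit Arguments. Unset Strict Implicit. Unset Printing Implicit Defensive.
Import GRing.Theory.
Local Open Scope ring_scope.

(* The monic polynomial t^n + g_{n-1} t^{n-1} + ... + g_0 attached to
   g : 'I_n -> F.  This is a bijection between {ffun 'I_n -> F} and the
   monic polynomials of degree n. *)
Definition mkpoly (F : finFieldType) (n : nat) (g : {ffun 'I_n -> F}) : {poly F} :=
  'X^n + \sum_(i < n) (g i)%:P * 'X^i.

Definition QA (F : finFieldType) (m : nat) (c : 'I_m.+1 -> F) (n : nat)
    (a : 'I_n.+1 -> F) (f : {poly F}) : F :=
  \sum_(j < m.+1) c j * (\sum_(j <= i < n.+1) f`_i * f`_(i - j))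
  + \sum_(i < n.+1) a i * f`_i.

Definition numP (F : finFieldType) (n : nat) : nat :=
  #|[set g : {ffun 'I_n -> F} | `[< irreducible_poly (mkpoly g) >] ]|.

Definition countQ (F : finFieldType) (m : nat) (c : 'I_m.+1 -> F) (n : nat)
    (a : 'I_n.+1 -> F) (gamma : F) : nat :=
  #|[set g : {ffun 'I_n -> F} |
      `[< irreducible_poly (mkpoly g) >] && (QA c a (mkpoly g) == gamma)]|.

(* Main.v *)
(** By orthogonality it suffices to save [q^(n/20)] in the sums over irreducible
    [f] of [psi (Q f)], for a nontrivial additive character [psi].  Writing [R]
    for coefficient reversal, the quadratic part of [Q f] is half a coefficient
    of [A * f * R f], where [A] is a fixed palindromic polynomial; as [R] is
    multiplicative, [Q (b * a)] is a Toeplitz quadratic form in [a] with symbol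
    [A * b * R b].

    Vaughan's identity with [U = V = rho := n / 10] leaves two kinds of sums.
    In type I sums, Weyl differencing bounds the sum over [a] by [q^((n+m)/2)],
    because a Toeplitz matrix whose symbol has a nonzero extreme coefficient has
    large rank.  In type II sums with [deg b = N <= K = deg a], Cauchy-Schwarz
    leads to the symbols [A * S], [S = b * R b - b' * R b'].  The sum over [a] is
    at most [q^(K - rho)] unless the kernel has codimension at most [2 rho];
    then it contains some [x <> 0] of degree below [2 rho], so the coefficients
    of [A * S] satisfy a short linear recurrence, which together with the
    symmetry of [S] leaves at most [q^(3 rho + O(m))] possible [S] up to a factor
    [n] (and only [S = 0] if [K >= N + m + 2 rho]).  Each [S] is taken at most as
    often as [S = 0], and [b * R b = b' * R b'] makes [b'] determined by
    [gcd (b, b')], so divisor moments bound the number of bad pairs. *)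

Require Import Defs.
From HB Require Import structures.
From mathcomp Require Import all_boot all_order all_fingroup all_algebra all_solvable all_field all_character.
From mathcomp Require Import boolp zify ring.
Set Implicit Arguments. Unset Strict Implicit. Unset Printing Implicit Defensive.
Import Order.TTheory GRing.Theory Num.Theory.
Local Open Scope ring_scope.

(** * Additive characters of a finite field, Weyl differencing, Cauchy-Schwarz *)

Definition additive_character (F : finFieldType) (psi : F -> algC) :=
  [/\ {morph psi : x y / x + y >-> x * y}, forall x, `|psi x| = 1
    & exists x, psi x != 1].

(** The additive group is abelian of order above 1, so it has more than one irreducible character,
    all of them linear. *)
Lemma additive_character_exists (F : finFieldType) :
  exists psi : F -> algC, additive_character psi.
Proof.
pose G := [set: F]%G.
have abG : abelian G by apply/centsP => x _ y _; apply: addrC.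
have cG : #|Iirr G| = #|F| by rewrite card_Iirr_abelian // cardsT.
have [i i_nz] : exists i : Iirr G, i != 0.
  apply/existsP; apply: contraTT (finNzRing_gt1 F) => /existsPn h.
  rewrite -cG -leqNgt; apply/card_le1_eqP => x y _ _.
  by rewrite (eqP (negbNE (h x))) (eqP (negbNE (h y))).
have lin_i : 'chi_i \is a linear_char by apply/char_abelianP.
exists (fun x => 'chi_i x); split=> [x y|x|].
- by rewrite -(lin_charM lin_i) ?inE.
- by rewrite normC_lin_char ?inE.
apply/existsP; apply: contraNT i_nz => /existsPn h.
rewrite -irr_eq1; apply/eqP/cfunP => x.
by rewrite cfun1E inE; apply/eqP/negbNE/h.
Qed.

Section Character.
Variables (F : finFieldType) (psi : F -> algC).
Hypothesis psiP : additive_character psi.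

Lemma psiD x y : psi (x + y) = psi x * psi y.
Proof. by case: psiP => ->. Qed.

Lemma norm_psi x : `|psi x| = 1.
Proof. by case: psiP => _ ->. Qed.

Lemma psi_neq0 x : psi x != 0.
Proof. by rewrite -normr_eq0 norm_psi oner_eq0. Qed.

Lemma psi0 : psi 0 = 1.
Proof.
have := psiD 0 0; rewrite addr0 => /eqP.
by rewrite -subr_eq0 -{1}[psi 0]mulr1 -mulrBr mulf_eq0 (negPf (psi_neq0 0))
     subr_eq0 => /eqP.
Qed.

Lemma psiN x : psi (- x) = (psi x)^*.
Proof.
apply: (mulfI (psi_neq0 x)); rewrite -psiD subrr psi0.
by rewrite -normCK norm_psi expr1n.
Qed.

(** Lets a nonzero frequency be absorbed into the character, so that a single phase has to be
    treated. *)
Lemma additive_character_scale a :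
  a != 0 -> additive_character (fun x => psi (a * x)).
Proof.
move=> a0; split=> [x y|x|]; rewrite ?mulrDr ?psiD ?norm_psi //.
case: psiP => _ _ [x psix]; exists (a^-1 * x); by rewrite mulrA mulfV ?mul1r.
Qed.

(** Translation by [v] multiplies the sum by [psi (L v)], which differs from 1. *)
Lemma sum_psi_additive (V : finZmodType) (L : V -> F) :
    {morph L : x y / x + y} -> (exists v, psi (L v) != 1) ->
  \sum_v psi (L v) = 0.
Proof.
move=> LD [v psiv]; apply/eqP; have /eqP : psi (L v) * (\sum_u psi (L u)) = \sum_u psi (L u).
  rewrite mulr_sumr [RHS](reindex_inj (addrI v)) /=.
  by apply: eq_bigr => u _; rewrite LD psiD.
by rewrite -subr_eq0 -{2}[\sum_u _]mul1r -mulrBl mulf_eq0 subr_eq0 (negPf psiv).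
Qed.

Lemma sum_psi_scale (x : F) : \sum_a psi (a * x) = (#|F| * (x == 0))%:R.
Proof.
have [->|x0] := eqVneq x 0.
  by under eq_bigr do rewrite mulr0 psi0; rewrite sumr_const muln1.
rewrite muln0; apply: (sum_psi_additive (L := fun a => a * x)) => [a b|].
  by rewrite mulrDl.
case: psiP => _ _ [y psiy]; exists (y / x); by rewrite divfK.
Qed.

(** Expand the squared modulus over pairs [(v + x, v)]. For fixed [x], [kap x] contributes a factor
    of modulus 1, and the sum over [v] vanishes unless [psi] is trivial on the image of [B x], in
    which case it is [#|V|]. *)
Lemma weyl_bound (V : finZmodType) (P kap : V -> F) (B : V -> V -> F) :
    (forall v x, P (v + x) - P v = kap x + B x v) ->
    (forall x, {morph B x : u v / u + v}) ->
  `|\sum_v psi (P v)| ^+ 2 <=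
    (#|V| * #|[set x | [forall v, psi (B x v) == 1]]|)%:R.
Proof.
move=> PB BD; rewrite -[X in X <= _]ger0_norm ?exprn_ge0 //.
rewrite normCK rmorph_sum /= big_distrlr /=.
have -> : \sum_i \sum_j psi (P i) * (psi (P j))^* =
          \sum_x psi (kap x) * \sum_v psi (B x v).
  rewrite exchange_big /=; under [RHS]eq_bigr do rewrite mulr_sumr.
  rewrite [RHS]exchange_big /=; apply: eq_bigr => v _.
  rewrite (reindex_inj (addrI v)) /=; apply: eq_bigr => x _.
  by rewrite -psiN -psiD PB psiD.
apply: le_trans (ler_norm_sum _ _ _) _.
rewrite (bigID (mem [set x | [forall v, psi (B x v) == 1]])) /=.
rewrite [X in _ + X]big1 ?addr0 => [|x]; last first.
  rewrite inE negb_forall => /existsP[v h].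
  by rewrite (@sum_psi_additive V (B x)) ?mulr0 ?normr0 //; exists v.
rewrite natrM mulr_natr -sumr_const; apply: ler_sum => x.
rewrite inE => /forallP h; rewrite normrM norm_psi mul1r.
by rewrite (eq_bigr (fun=> 1)) ?sumr_const ?normr_nat // => v _; apply/eqP.
Qed.
End Character.

Lemma CauchySchwarz_seq (I : Type) (r : seq I) (a b : I -> algC) :
  `|\sum_(i <- r) a i * b i| ^+ 2 <=
  (\sum_(i <- r) `|a i| ^+ 2) * (\sum_(i <- r) `|b i| ^+ 2).
Proof.
apply: le_trans (_ : (\sum_(i <- r) `|a i| * `|b i|) ^+ 2 <= _).
  rewrite lerXn2r ?nnegrE ?normr_ge0 //.
    by apply: sumr_ge0 => i _; rewrite mulr_ge0.
  apply: le_trans (ler_norm_sum _ _ _) _.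
  by apply: ler_sum => i _; rewrite normrM.
rewrite -subr_ge0.
(* Lagrange's identity: the gap is half a sum of squares. *)
have -> : (\sum_(i <- r) `|a i| ^+ 2) * (\sum_(i <- r) `|b i| ^+ 2) -
   (\sum_(i <- r) `|a i| * `|b i|) ^+ 2 =
   2^-1 * \sum_(i <- r) \sum_(j <- r) (`|a i| * `|b j| - `|a j| * `|b i|) ^+ 2.
  rewrite expr2 !big_distrlr /=.
  have -> : \sum_(i <- r) \sum_(j <- r) (`|a i| * `|b j| - `|a j| * `|b i|) ^+ 2
    = \sum_(i <- r) \sum_(j <- r) `|a i| ^+ 2 * `|b j| ^+ 2
    + \sum_(i <- r) \sum_(j <- r) `|a j| ^+ 2 * `|b i| ^+ 2
    - 2 * (\sum_(i <- r) \sum_(j <- r) `|a i| * `|b i| * (`|a j| * `|b j|)).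
    rewrite mulr_sumr -!sumrN -!big_split /=; apply: eq_bigr => i _.
    rewrite mulr_sumr -!sumrN -!big_split /=; apply: eq_bigr => j _.
    ring.
  rewrite [X in _ + X - _]exchange_big /=.
  set X := \sum_(i <- r) _; set Y := \sum_(i <- r) _.
  by field.
rewrite mulr_ge0 ?invr_ge0 ?ler0n //; apply: sumr_ge0 => i _; apply: sumr_ge0 => j _.
by rewrite real_exprn_even_ge0 // rpredB // rpredM // normr_real.
Qed.

(** * Coefficient reversal and palindromic polynomials *)

Section Reversal.
Variable F : fieldType.
Implicit Types p r x y G H : {poly F}.

(** For [deg p <= N] this is [X^N * p(1/X)]. Fixing [N] independently of [p] makes the map linear,
    and involutive even when the constant term of [p] vanishes. *)
Definition rev_poly N p : {poly F} := \poly_(i < N.+1) p`_(N - i).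

Lemma coef_rev_poly N p i :
  (rev_poly N p)`_i = if (i <= N)%N then p`_(N - i) else 0.
Proof. by rewrite coef_poly ltnS. Qed.

Lemma size_rev_poly N p : (size (rev_poly N p) <= N.+1)%N.
Proof. exact: size_poly. Qed.

Fact rev_poly_is_linear N : linear (rev_poly N).
Proof.
move=> a p r; apply/polyP => i; rewrite coefD coefZ !coef_rev_poly coefD coefZ.
by case: ifP => // _; rewrite mulr0 addr0.
Qed.
HB.instance Definition _ N :=
  GRing.isLinear.Build F {poly F} {poly F} _ (rev_poly N) (rev_poly_is_linear N).

Lemma rev_polyK N p : (size p <= N.+1)%N -> rev_poly N (rev_poly N p) = p.
Proof.
move=> sp; apply/polyP => i; rewrite !coef_rev_poly leq_subr.
by case: leqP => [iN|Ni]; rewrite ?subKn // nth_default // (leq_trans sp).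
Qed.

Lemma rev_polyXn N i : (i <= N)%N -> rev_poly N 'X^i = 'X^(N - i).
Proof.
move=> iN; apply/polyP => j; rewrite coef_rev_poly !coefXn.
case: leqP => jN; first by congr (nat_of_bool _)%:R; apply/eqP/eqP; lia.
case: eqP => //; lia.
Qed.

Lemma poly_sumXn N p :
  (size p <= N)%N -> p = \sum_(i < N) p`_i *: 'X^i.
Proof.
move=> sp; rewrite -poly_def.
apply/polyP => i; rewrite coef_poly; case: ltnP => // Ni.
by rewrite nth_default // (leq_trans sp).
Qed.

(** By bilinearity it suffices to multiply monomials. *)
Lemma rev_polyM N K p r : (size p <= N.+1)%N -> (size r <= K.+1)%N ->
  rev_poly (N + K) (p * r) = rev_poly N p * rev_poly K r.
Proof.
move=> sp sr; rewrite {1 2}(poly_sumXn sp) (poly_sumXn sr) !linear_sum.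
rewrite !big_distrlr /= linear_sum; apply: eq_bigr => i _.
rewrite linear_sum; apply: eq_bigr => j _ /=.
have := ltn_ord i; have := ltn_ord j; rewrite !ltnS => jK iN.
rewrite -scalerAl -scalerAr -exprD !linearZ /= !rev_polyXn ?leq_add //.
rewrite -scalerAl -scalerAr -exprD; congr (_ *: (_ *: 'X^_)); lia.
Qed.

(* [palindromic c G] says that [G / X^c] is a symmetric Laurent polynomial. *)
Definition palindromic c G := rev_poly (c + c) G == G.

Lemma size_palindromic c G : palindromic c G -> (size G <= (c + c).+1)%N.
Proof. by move=> /eqP pG; rewrite -pG size_rev_poly. Qed.

Lemma palindromicM c d G H :
  palindromic c G -> palindromic d H -> palindromic (c + d) (G * H).
Proof.
move=> pG pH; rewrite /palindromic addnACA rev_polyM ?size_palindromic //.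
by rewrite (eqP pG) (eqP pH).
Qed.

Lemma palindromicB c G H :
  palindromic c G -> palindromic c H -> palindromic c (G - H).
Proof. by move=> /eqP pG /eqP pH; rewrite /palindromic linearB /= pG pH. Qed.

Lemma palindromic_mul_rev N p :
  (size p <= N.+1)%N -> palindromic N (p * rev_poly N p).
Proof.
move=> sp; rewrite /palindromic rev_polyM ?size_rev_poly // rev_polyK //.
by rewrite mulrC.
Qed.

Lemma coef_palindromic c G i :
  palindromic c G -> (i <= c)%N -> G`_(c - i) = G`_(c + i).
Proof.
move=> /eqP pG ic; rewrite -{1}pG coef_rev_poly.
case: leqP => [_|]; last lia.
congr (G`_ _); lia.
Qed.

(** A nonzero coefficient below the centre [c] has a mirror image above it. *)
Lemma palindromic_size_gt c G : palindromic c G -> G != 0 -> (c < size G)%N.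
Proof.
move=> pG; apply: contraNT; rewrite -leqNgt => sG.
apply/eqP/polyP => i; rewrite coef0.
have [ci|ic] := leqP c i; first by rewrite nth_default // (leq_trans sG).
have /subKn <- : (i <= c)%N by apply: ltnW.
rewrite coef_palindromic ?leq_subr // nth_default // (leq_trans sG) //.
exact: leq_addr.
Qed.

Lemma coef_mul_rev c K H y :
  (H * rev_poly K y)`_(c + K) = \sum_(i < K.+1) y`_i * H`_(c + i).
Proof.
rewrite coefMr -(big_mkord xpredT (fun j => H`_(c + K - j) * (rev_poly K y)`_j)).
rewrite (@big_cat_nat _ _ _ K.+1) //=; last lia.
rewrite [X in _ + X]big_nat_cond [X in _ + X]big1 ?addr0 => [|j]; last first.
  by rewrite andbT => /andP[Kj _]; rewrite coef_rev_poly leqNgt Kj mulr0.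
rewrite big_nat_rev /= add0n big_mkord; apply: eq_bigr => i _.
have iK := ltn_ord i.
rewrite coef_rev_poly subSS leq_subr subKn // mulrC; congr (_ * H`_ _); lia.
Qed.

(** Symmetry of the Toeplitz form with symbol [G / X^c]: reversing the whole product at length
    [c + c + K + K] exchanges [x] and [y] and fixes the middle coefficient. *)
Lemma palindromic_bilC c K G x y : palindromic c G ->
    (size x <= K.+1)%N -> (size y <= K.+1)%N ->
  (G * x * rev_poly K y)`_(c + K) = (G * y * rev_poly K x)`_(c + K).
Proof.
move=> pG sx sy.
have -> : G * y * rev_poly K x =
    rev_poly (c + c + K + K) (G * x * rev_poly K y).
  rewrite rev_polyM ?size_rev_poly ?rev_polyK //; last first.
    by apply: leq_trans (size_polyMleq _ _) _; have := size_palindromic pG; lia.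
  by rewrite rev_polyM ?size_palindromic // (eqP pG) mulrAC.
rewrite coef_rev_poly; case: leqP => [_|]; last lia.
congr (_`_ _); lia.
Qed.

End Reversal.

(** * The palindromic symbol of the quadratic form *)

Section Symbol.
Variables (F : fieldType) (m : nat) (c : 'I_m.+1 -> F).

(** This is [X^m] times a symmetric Laurent polynomial. The term [j = 0] counts [c 0] twice, in
    accordance with the factor 2 in [symbol_quadratic]. *)
Definition symbol : {poly F} :=
  \sum_(j < m.+1) c j *: ('X^(m + j) + 'X^(m - j)).

Lemma palindromic_symbol : palindromic m symbol.
Proof.
rewrite /palindromic /symbol linear_sum; apply/eqP/eq_bigr => j _ /=.
have jm := ltn_ord j; rewrite linearZ /= linearD /= !rev_polyXn; try lia.
rewrite addrC; congr (_ *: ('X^_ + 'X^_)); lia.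
Qed.

(** The coefficient is [c ord_max], doubled when [m = 0]. *)
Lemma symbol_coef0 : (2 : F) != 0 -> c ord_max != 0 -> symbol`_0 != 0.
Proof.
move=> two_nz cm; rewrite coef_sum (bigD1 ord_max) //= big1 => [|j jm].
  rewrite addr0 coefZ coefD !coefXn subnn eqxx mulf_neq0 //.
  by case: (m) => [|k] //=; rewrite add0r oner_eq0.
rewrite coefZ coefD !coefXn.
have jm' : (j < m)%N by rewrite ltn_neqAle -ltnS ltn_ord andbT.
case: eqP => [|_]; first lia.
by case: eqP => [|_]; [lia | rewrite addr0 mulr0].
Qed.

Lemma size_symbol : (2 : F) != 0 -> c ord_max != 0 -> size symbol = (m + m).+1.
Proof.
move=> two_nz cm; apply/eqP; rewrite eqn_leq size_palindromic ?palindromic_symbol //=.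
rewrite ltnNge; apply/negP => s.
have := symbol_coef0 two_nz cm.
by rewrite -{1}(subnn m) (coef_palindromic palindromic_symbol) // nth_default ?eqxx.
Qed.

Lemma autocorrelation_coef n (f : {poly F}) j : (size f <= n.+1)%N ->
  (f * rev_poly n f)`_(n + j) = \sum_(j <= i < n.+1) f`_i * f`_(i - j).
Proof.
move=> sf; rewrite addnC coef_mul_rev -(big_mkord xpredT (fun i => f`_i * f`_(j + i))).
have [jn|nj] := leqP j n; last first.
  rewrite [RHS]big_geq // big1 // => i _.
  by rewrite [f`_(j + i)]nth_default ?mulr0 // (leq_trans sf) // (leq_trans nj) // leq_addr.
rewrite (@big_cat_nat _ _ _ (n.+1 - j)) ?leq_subr //=.
rewrite [X in _ + X]big_nat_cond [X in _ + X]big1 ?addr0 => [|i]; last first.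
  rewrite andbT => /andP[ji _]; rewrite [f`_(j + i)]nth_default ?mulr0 //.
  apply: (leq_trans sf); lia.
rewrite -[RHS]/(\sum_(0 + j <= i < n.+1) f`_i * f`_(i - j)) big_addn; apply: eq_bigr => i _.
by rewrite addnK addnC mulrC.
Qed.

(** The two monomials attached to [c j] pick the coefficients [n - j] and [n + j] of
    [f * rev_poly n f], which agree by symmetry. For [j > n] everything vanishes, as [n + j] exceeds
    the degree [2 n]. *)
Lemma symbol_quadratic n (f : {poly F}) : (size f <= n.+1)%N ->
  2 * \sum_(j < m.+1) c j * (\sum_(j <= i < n.+1) f`_i * f`_(i - j)) =
  (symbol * (f * rev_poly n f))`_(n + m).
Proof.
move=> sf; rewrite /symbol [in RHS]mulr_suml coef_sum [LHS]mulr_sumr; apply: eq_bigr => j _.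
rewrite -autocorrelation_coef // -scalerAl coefZ [in RHS]mulrDl coefD !coefXnM.
have jm := ltn_ord j; case: ltnP => [h1|h1]; case: ltnP => [h2|h2]; try lia.
  have sP := size_palindromic (palindromic_mul_rev sf).
  rewrite add0r !nth_default ?mulr0 //; apply: (leq_trans sP); lia.
have -> : (n + m - (m + j) = n - j)%N by lia.
have -> : (n + m - (m - j) = n + j)%N by lia.
rewrite (coef_palindromic (palindromic_mul_rev sf)); last lia.
ring.
Qed.
End Symbol.

(** * Monic polynomials of a given degree *)

Section Monics.
Variable F : finFieldType.
Implicit Types p f : {poly F}.
Local Notation q := #|F|.

(** A sequence, as [{poly F}] is infinite. Being an image of row vectors, it turns a sum over monics
    into a sum over a finite group, where Weyl differencing applies. *)
Definition monics k : seq {poly F} := [seq 'X^k + rVpoly v | v : 'rV[F]_k].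

Lemma size_monic_rV k (v : 'rV[F]_k) : size ('X^k + rVpoly v) = k.+1.
Proof. by rewrite size_polyDl size_polyXn // ltnS size_poly. Qed.

Lemma mem_monics k p : (p \in monics k) = (p \is monic) && (size p == k.+1).
Proof.
apply/imageP/andP => [[v _ ->]|[mp /eqP sp]].
  rewrite size_monic_rV eqxx; split=> //.
  by rewrite monicE lead_coefDl ?size_polyXn ?ltnS ?size_poly // lead_coefXn.
exists (poly_rV (p - 'X^k)) => //; rewrite poly_rV_K ?subrKC //.
apply/leq_sizeP => j; rewrite leq_eqVlt coefB coefXn => /predU1P[<-|kj].
  by rewrite eqxx -(monicP mp) lead_coefE sp subrr.
by rewrite (gtn_eqF kj) subr0 nth_default // sp.
Qed.

Lemma monics_uniq k : uniq (monics k).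
Proof.
rewrite map_inj_uniq ?enum_uniq // => u v /addrI.
exact: (can_inj rVpolyK).
Qed.

Lemma size_monics k : size (monics k) = (q ^ k)%N.
Proof. by rewrite size_map -cardE card_mx mul1n. Qed.

Lemma big_monics (R : Type) (idx : R) (op : Monoid.com_law idx) k (E : {poly F} -> R) :
  \big[op/idx]_(f <- monics k) E f = \big[op/idx]_(v : 'rV[F]_k) E ('X^k + rVpoly v).
Proof. by rewrite big_image. Qed.

Lemma monicsM j k d g : d \in monics j -> g \in monics k -> d * g \in monics (j + k).
Proof.
rewrite !mem_monics => /andP[md /eqP sd] /andP[mg /eqP sg].
by rewrite monicMl // mg size_monicM ?monic_neq0 // sd sg addnS addSn /=.
Qed.

Lemma monics_size k f : f \in monics k -> size f = k.+1.
Proof. by rewrite mem_monics => /andP[_ /eqP]. Qed.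

Lemma monics_monic k f : f \in monics k -> f \is monic.
Proof. by rewrite mem_monics => /andP[]. Qed.

Lemma monics_neq0 k f : f \in monics k -> f != 0.
Proof. by move/monics_monic/monic_neq0. Qed.

End Monics.

(** * Kernels of Toeplitz matrices with palindromic symbols *)

Section ToeplitzKernel.
Variable F : finFieldType.
Hypothesis two_neq0 : (2 : F) != 0.
Local Notation q := #|F|.

(** The kernel of the [K] by [K] Toeplitz matrix with symbol [G / X^c]. *)
Definition toeplitz_ker c K (G : {poly F}) : {set 'rV[F]_K} :=
  [set x | [forall i : 'I_K, (G * rVpoly x)`_(c + i) == 0]].

(** Weyl differencing in [a = X^K + v]. Symmetry of the Toeplitz form makes the two cross terms
    equal, which cancels [2^-1]; the linear part [ell] enters only through [kap]. *)
Lemma quadratic_sum_bound (psi : F -> algC) c K (G : {poly F}) (ell : {poly F} -> F) :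
    additive_character psi -> palindromic c G -> {morph ell : x y / x + y} ->
  `|\sum_(a <- monics F K)
       psi (2^-1 * (G * (a * rev_poly K a))`_(c + K) + ell a)| ^+ 2
    <= (q ^ K * #|toeplitz_ker c K G|)%:R.
Proof.
move=> psiP pG ellD; rewrite big_monics.
pose P (v : 'rV[F]_K) := 2^-1 * (G * (('X^K + rVpoly v) * rev_poly K ('X^K + rVpoly v)))`_(c + K)
   + ell ('X^K + rVpoly v).
pose B (x v : 'rV[F]_K) := (G * rVpoly x * rev_poly K (rVpoly v))`_(c + K).
pose kap (x : 'rV[F]_K) := (G * rVpoly x * rev_poly K 'X^K)`_(c + K)
  + 2^-1 * (G * rVpoly x * rev_poly K (rVpoly x))`_(c + K) + ell (rVpoly x).
have BD x : {morph B x : u v / u + v}.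
  by move=> u v; rewrite /B !linearD /= mulrDr coefD.
have PB v x : P (v + x) - P v = kap x + B x v.
  have sa := size_monic_rV v; have sx : (size (rVpoly x) <= K.+1)%N.
    by rewrite (leq_trans (size_poly _ _)).
  rewrite /P linearD addrA /=; set a := 'X^K + rVpoly v in sa *.
  have : (G * rVpoly x * rev_poly K a)`_(c + K) = (G * rVpoly x * rev_poly K 'X^K)`_(c + K)
    + B x v by rewrite /a linearD /= mulrDr coefD.
  have := palindromic_bilC pG sx (eq_leq sa).
  clearbody a; rewrite /kap [rev_poly K (a + _)]linearD /= ellD.
  rewrite !mulrDl !mulrDr !mulrA !coefD => <- ->.
  set X := (G * _ * _)`_ _; set Y := _`_ _; set Z := _`_ _.
  by field.
apply: le_trans (weyl_bound psiP PB BD) _.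
rewrite card_mx mul1n ler_nat leq_mul2l subset_leq_card ?orbT //.
apply/subsetP => x; rewrite !inE => /forallP psi1; apply/forallP => i.
(* If coefficient [c + i] of [G * x] were some [t != 0], taking for [v] the monomial [(y / t) X^i]
   would give [B x v = y] with [psi y != 1]. *)
apply: contraT => nz; case: (psiP) => _ _ [y /negP []].
set t := (G * _)`_ _ in nz.
suff <- : B x ((y / t) *: delta_mx 0 i) = y by apply: psi1.
rewrite /B linearZ /= linearZ /= -scalerAr coefZ rVpoly_delta rev_polyXn ?(ltnW (ltn_ord i)) //.
rewrite coefMXn; case: ltnP => [|_]; first by have := ltn_ord i; lia.
have -> : (c + K - (K - i) = c + i)%N by have := ltn_ord i; lia.
by rewrite divfK.
Qed.

(* Pigeonhole on the top [K - r] coefficients. *)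
Lemma toeplitz_ker_low c K r (G : {poly F}) : (r <= K)%N ->
    (q ^ (K - r) < #|toeplitz_ker c K G|)%N ->
  exists x : {poly F},
    [/\ x != 0, (size x <= r)%N & forall i, (i < K)%N -> (G * x)`_(c + i) = 0].
Proof.
move=> rK lt_ker.
pose h (x : 'rV[F]_K) := \row_(i < K - r) (rVpoly x)`_(r + i).
have : ~~ dinjectiveb h (mem (toeplitz_ker c K G)).
  apply: contraTN lt_ker => /dinjectiveP inj_h; rewrite -leqNgt.
  by have := leq_card_in h (toeplitz_ker c K G) inj_h; rewrite card_mx mul1n.
case/dinjectivePn => x kx [y]; rewrite inE /= => /andP[yx ky] hxy.
exists (rVpoly (x - y)); split.
- apply: contra yx => /eqP z; rewrite eq_sym -subr_eq0; apply/eqP.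
  by apply: (can_inj rVpolyK); rewrite z linear0.
- apply/leq_sizeP => j rj; have [jK|Kj] := ltnP j K; last first.
    by rewrite nth_default // (leq_trans (size_poly _ _)).
  have jr : (j - r < K - r)%N by lia.
  have := congr1 (fun M : 'rV__ => M 0 (Ordinal jr)) hxy.
  by rewrite !mxE /= subnKC // linearB coefB /= => ->; rewrite subrr.
move=> i iK; move: kx ky; rewrite !inE => /forallP/(_ (Ordinal iK))/eqP /= kx.
move=> /forallP/(_ (Ordinal iK))/eqP /= ky.
by rewrite linearB /= mulrBr coefB kx ky subrr.
Qed.

Variables (m : nat) (c : 'I_m.+1 -> F).
Hypothesis cm : c ord_max != 0.
Local Notation A := (symbol c).

(** As [S] has degree between [N] and [2 N], for larger [K] the leading coefficient of [A * S * x]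
    would be among the [K] vanishing ones. *)
Lemma symbol_ker_size N K (S x : {poly F}) : palindromic N S -> S != 0 -> x != 0 ->
    (forall i, (i < K)%N -> (A * S * x)`_(N + m + i) = 0) ->
  (K < N + m + size x)%N.
Proof.
move=> pS S0 x0 kx; have sA := size_symbol two_neq0 cm.
have A0 : A != 0 by rewrite -size_poly_eq0 sA.
have P0 : A * S * x != 0 by rewrite !mulf_neq0.
have sx : (0 < size x)%N by rewrite size_poly_gt0.
have sP : size (A * S * x) = (m + m + size S + (size x).-1)%N.
  rewrite !size_mul ?mulf_neq0 // sA; move: sx.
  by move: (size S) (size x) => a b; lia.
have sS := size_palindromic pS; have sS' := palindromic_size_gt pS S0.
rewrite ltnNge; apply/negP => h.
have := kx (m + size S + (size x).-1 - 1 - N)%N.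
have -> : (N + m + (m + size S + (size x).-1 - 1 - N) = (size (A * S * x)%R).-1)%N.
  by rewrite sP; move: sx sS sS'; move: (size S) (size x) => a b; lia.
move=> h'; suff : lead_coef (A * S * x) = 0 by move/eqP; rewrite lead_coef_eq0 (negPf P0).
rewrite lead_coefE h' //; move: h sx sS sS'; move: (size S) (size x) => a b; lia.
Qed.

(** A larger kernel would, by [toeplitz_ker_low] with [r = K - (N + m)], contain a nonzero vector
    too short for [symbol_ker_size]. *)
Lemma symbol_ker_card N K (S : {poly F}) : palindromic N S -> S != 0 ->
  (#|toeplitz_ker (N + m) K (A * S)| <= q ^ (N + m))%N.
Proof.
move=> pS S0; have [KNm|NmK] := leqP K (N + m).
  rewrite (leq_trans (max_card _)) // card_mx mul1n leq_exp2l //.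
  exact: finNzRing_gt1.
rewrite leqNgt; apply/negP => h.
have [||x [x0 sx kx]] := @toeplitz_ker_low (N + m) K (K - (N + m)) (A * S); first exact: leq_subr.
  by rewrite subKn // ltnW.
have := symbol_ker_size pS S0 x0 kx; lia.
Qed.

(** [D] is recovered from its centre outwards: [x] gives a recurrence for the coefficients of
    [A * D], and symmetry supplies its starting values from half as many coefficients. The top
    [j + 1] coefficients of [D] make up for the equations lost when [X^j] is divided out of a kernel
    vector. *)
Lemma palindromic_recurrence N K j e (D x : {poly F}) :
    palindromic N D -> (N <= K)%N -> (size x <= e.+1)%N -> x`_0 != 0 ->
    (forall i, (i + j < K)%N -> (A * D * x)`_(N + m + i) = 0) ->
    (forall i, (i <= m.*2 + e./2)%N -> D`_(N + i) = 0) ->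
    (forall i, (N <= i + j)%N -> (i <= N)%N -> D`_(N + i) = 0) ->
  D = 0.
Proof.
move=> pD NK sx x0 kx low high.
have pA := palindromic_symbol c; have sA := size_palindromic pA.
have pG := palindromicM pA pD; rewrite addnC in pG.
set G := A * D in pG kx.
have D0 k : (N <= k + (m.*2 + e./2))%N -> (k <= N + (m.*2 + e./2))%N -> D`_k = 0.
  move=> h1 h2; have [Nk|kN] := leqP N k.
    by rewrite -(subnKC Nk) low //; lia.
  have := coef_palindromic pD (leq_subr k N); rewrite subKn ?(ltnW kN) // => ->.
  by rewrite low //; lia.
have G0 i : (i + j < K)%N -> G`_(N + m + i) = 0.
  elim/ltn_ind: i => i IH ij.
  have [ile|igt] := leqP i (m + e./2).
    rewrite coefM big1 // => l _; have [lm|ml] := leqP l (m + m).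
      by rewrite D0 ?mulr0 //; lia.
    by rewrite [A`_l]nth_default ?mul0r //; apply: leq_trans ml.
  have /eqP := kx i ij; rewrite coefMr -(big_mkord xpredT (fun l => G`_(N + m + i - l) * x`_l)).
  rewrite big_ltn // subn0 big_nat_cond big1 => [|l].
    by rewrite addr0 mulf_eq0 (negPf x0) orbF => /eqP.
  rewrite andbT => /andP[l0 lt_l]; have [le|el] := leqP l e; last first.
    by rewrite [x`_l]nth_default ?mulr0 //; apply: leq_trans el.
  have [li|il] := leqP l i.
    by rewrite -addnBA // IH ?mul0r //; lia.
  have -> : (N + m + i - l = N + m - (l - i))%N by lia.
  rewrite coef_palindromic //; last lia.
  by rewrite IH ?mul0r //; lia.
have DN i : D`_(N + i) = 0.
  elim/ltn_ind: i => i IH.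
  have [/low //|ilow] := leqP i (m.*2 + e./2).
  have [Ni|iN] := ltnP N i.
    rewrite nth_default //; apply: (leq_trans (size_palindromic pD)); lia.
  have [/high -> //|hi] := leqP N (i + j).
  have /eqP := G0 (i - m)%N ltac:(lia).
  have -> : (N + m + (i - m) = N + i)%N by lia.
  rewrite coefM -(big_mkord xpredT (fun l => A`_l * D`_(N + i - l))).
  rewrite big_ltn // subn0 big_nat_cond big1 => [|l].
    by rewrite addr0 mulf_eq0 (negPf (symbol_coef0 two_neq0 cm)) => /eqP.
  rewrite andbT => /andP[l0 lt_l]; have [lm|ml] := leqP l (m + m); last first.
    by rewrite [A`_l]nth_default ?mul0r //; apply: leq_trans ml.
  by rewrite -addnBA ?IH ?mulr0 //; lia.
apply/eqP; apply: contraT => nzD.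
have sD := palindromic_size_gt pD nzD.
have := lead_coef_eq0 D; rewrite (negPf nzD) lead_coefE.
have /subnKC <- : (N <= (size D).-1)%N by rewrite -ltnS prednK // (leq_trans _ sD).
by rewrite DN eqxx.
Qed.

Definition bad_symbols N K r : {set 'rV[F]_(N + N).+1} :=
  [set S | palindromic N (rVpoly S) &
           (q ^ (K - r) < #|toeplitz_ker (N + m) K (A * rVpoly S)|)%N].

(** Here [x] stands for a kernel vector stripped of its factor [X^j], for which the equations with
    [i + j < K] remain. *)
Definition annihilated N K j e (x : 'rV[F]_e) : {set 'rV[F]_(N + N).+1} :=
  [set S | [&& palindromic N (rVpoly S), (rVpoly x)`_0 != 0 &
     [forall i : 'I_K, (i + j < K)%N ==> ((A * rVpoly S * rVpoly x)`_(N + m + i) == 0)]]].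

(** [S] is determined by its central and top blocks: [palindromic_recurrence] applies to the
    difference of two members that share them. *)
Lemma card_annihilated N K j e (x : 'rV[F]_e.+1) : (N <= K)%N ->
  (#|annihilated N K j x| <= q ^ (m.*2 + e./2 + j + 2))%N.
Proof.
move=> NK.
pose h (S : 'rV[F]_(N + N).+1) :=
  (\row_(i < (m.*2 + e./2).+1) (rVpoly S)`_(N + i),
   \row_(i < j.+1) (rVpoly S)`_(N + (N - j + i))).
have hinj : {in annihilated N K j x &, injective h}.
  move=> S T; rewrite !inE => /and3P[pS x0 /forallP kS] /and3P[pT _ /forallP kT] [h1 h2].
  apply/eqP; rewrite -subr_eq0; apply/eqP; apply: (can_inj rVpolyK); rewrite linear0.
  apply: (@palindromic_recurrence N K j e _ (rVpoly x)) => //.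
  - by rewrite linearB palindromicB.
  - exact: size_poly.
  - move=> i ij; have iK : (i < K)%N by lia.
    have := kS (Ordinal iK); have := kT (Ordinal iK); rewrite /= ij /= => /eqP kT' /eqP kS'.
    by rewrite linearB mulrBr mulrBl coefB kS' kT' subrr.
  - move=> i; rewrite -ltnS => il.
    have := congr1 (fun M : 'rV__ => M 0 (Ordinal il)) h1.
    by rewrite !mxE linearB coefB /= => ->; rewrite subrr.
  - move=> i Ni iN; have il : (i - (N - j) < j.+1)%N by lia.
    have := congr1 (fun M : 'rV__ => M 0 (Ordinal il)) h2.
    have e' : (N - j + (i - (N - j)) = i)%N by lia.
    by rewrite !mxE /= e' linearB coefB /= => ->; rewrite subrr.
apply: leq_trans (leq_card_in h (annihilated N K j x) hinj) _.
rewrite card_prod !card_mx !mul1n -expnD leq_exp2l ?finNzRing_gt1 //; lia.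
Qed.

(** The 1 accounts for [S = 0]. A nonzero bad [S] has a kernel vector of size at most [r], so
    [symbol_ker_size] forces [K < N + m + r], and [S] lies in [annihilated] for some [j < r] and
    some stripped vector. *)
Lemma card_bad_symbols N K r : (N <= K)%N -> (r <= K)%N ->
  (#|bad_symbols N K r| <= 1 + (K < N + m + r) * (r * q ^ (r + r./2 + m.*2 + 2)))%N.
Proof.
move=> NK rK.
have wit (S : 'rV[F]_(N + N).+1) : S \in bad_symbols N K r :\ 0 ->
    (K < N + m + r)%N /\ exists j : 'I_r, exists x : 'rV[F]_(r - j.+1).+1, S \in annihilated N K j x.
  rewrite !inE => /and3P[S0 pS ker].
  have S0' : rVpoly S != 0.
    by apply: contra S0 => /eqP z; apply/eqP/(can_inj rVpolyK); rewrite z linear0.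
  have [x [x0 sx kx]] := toeplitz_ker_low rK ker.
  split; first by have := symbol_ker_size pS S0' x0 kx; lia.
  (* Dividing [x] by the exact power [X^j] gives the recurrence a nonzero constant term. *)
  have [j [y]] := multiplicity_XsubC x 0; rewrite x0 /= subr0 => ry xE.
  have y0 : y != 0 by apply: contraNneq x0 => y0; rewrite xE y0 mul0r.
  have sxE : size x = (size y + j)%N by rewrite xE size_mulXn // addnC.
  have sy : (0 < size y)%N by rewrite size_poly_gt0.
  have jr : (j < r)%N by move: sx sy; rewrite sxE; move: (size y) => a; lia.
  exists (Ordinal jr), (poly_rV y).
  rewrite inE pS poly_rV_K /=; last by move: sx; rewrite sxE; move: (size y) => a; lia.
  rewrite -horner_coef0 -rootE ry /=; apply/forallP => i; apply/implyP => ij; apply/eqP.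
  have := kx _ ij; rewrite xE mulrA coefMXn addnA ltnNge leq_addl /=.
  by rewrite addnK.
set B0 := bad_symbols N K r :\ 0 in wit *.
apply: (@leq_trans (1 + #|B0|)).
  by rewrite (cardsD1 0 (bad_symbols N K r)) leq_add2r; case: (_ \in _).
rewrite leq_add2l; case: ltnP => h; last first.
  rewrite mul0n leqn0 cards_eq0; apply/eqP/setP => S; rewrite [in RHS]inE.
  by apply/negP => /wit[]; lia.
rewrite mul1n -sum1_card.
apply: (@leq_trans (\sum_(S in B0)
   \sum_(j < r) \sum_(x : 'rV[F]_(r - j.+1).+1) (S \in annihilated N K j x)))%N.
  apply: leq_sum => S /wit[_ [j [x Sx]]].
  by rewrite (bigD1 j) //= (bigD1 x) //= Sx.
rewrite exchange_big /=.
apply: (@leq_trans (\sum_(j < r) q ^ (r + r./2 + m.*2 + 2)))%N; last first.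
  by rewrite sum_nat_const card_ord.
apply: leq_sum => j _.
rewrite exchange_big /=.
(* The [r - j] coefficients of [x] and the [j] free top coefficients of [S] balance, so the bound is
   uniform in [j]. *)
apply: (@leq_trans (\sum_(x : 'rV[F]_(r - j.+1).+1) q ^ (m.*2 + (r - j.+1)./2 + j + 2)))%N.
  apply: leq_sum => x _; apply: leq_trans (@card_annihilated N K j _ x NK).
  rewrite -sum1_card [X in (_ <= X)%N]big_mkcond [X in (X <= _)%N]big_mkcond; apply: leq_sum => S _.
  by case: ifP; case: ifP.
rewrite sum_nat_const card_mx mul1n -expnD leq_exp2l ?finNzRing_gt1 //.
have := ltn_ord j; lia.
Qed.

End ToeplitzKernel.

(** * Divisor moments and coincidences of autocorrelations *)

Section Divisors.
Variable F : finFieldType.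
Implicit Types p f d g : {poly F}.
Local Notation q := #|F|.
Local Notation monics := (monics F).

Fixpoint monics_le n : seq {poly F} :=
  if n is k.+1 then monics_le k ++ monics n else monics 0.

Lemma mem_monics_le n p :
  (p \in monics_le n) = (p \is monic) && (size p <= n.+1)%N.
Proof.
elim: n => [|n IH] /=; last rewrite mem_cat IH; rewrite mem_monics.
  by case: (boolP (p \is monic)) => //= /monic_neq0; rewrite -size_poly_gt0 eqn_leq => ->; rewrite andbT.
by case: (p \is monic) => //=; rewrite [in RHS]leq_eqVlt orbC.
Qed.

Lemma monics_le_uniq n : uniq (monics_le n).
Proof.
elim: n => [|n IH] /=; first exact: monics_uniq.
rewrite cat_uniq IH monics_uniq andbT /=; apply/hasPn => p.
rewrite mem_monics mem_monics_le => /andP[_ /eqP ->].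
by rewrite ltnn andbF.
Qed.

Lemma big_monics_le (R : Type) (idx : R) (op : Monoid.com_law idx) n
    (P : pred {poly F}) (E : {poly F} -> R) :
  \big[op/idx]_(f <- monics_le n | P f) E f =
  \big[op/idx]_(k < n.+1) \big[op/idx]_(f <- monics k | P f) E f.
Proof.
elim: n => [|n IH]; first by rewrite big_ord_recl big_ord0 Monoid.mulm1.
by rewrite big_ord_recr big_cat IH.
Qed.

Lemma monic_dvd_size p f : f != 0 -> p %| f -> (size p <= (size f).-1.+1)%N.
Proof. by move=> f0 /(dvdp_leq f0) /leq_trans ->; rewrite ?leqSpred. Qed.

Definition mdivs f := [seq d <- monics_le (size f).-1 | d %| f].

Lemma mem_mdivs f d : f != 0 -> (d \in mdivs f) = (d \is monic) && (d %| f).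
Proof.
move=> f0; rewrite mem_filter mem_monics_le andbC -andbA; congr andb.
by case: (boolP (d %| f)) => [/(monic_dvd_size f0) ->|]; rewrite ?andbF.
Qed.

Lemma mdivs_uniq f : uniq (mdivs f).
Proof. exact/filter_uniq/monics_le_uniq. Qed.

Definition tau f := size (mdivs f).

Lemma big_mdivs (R : Type) (idx : R) (op : Monoid.com_law idx) n f
    (E : {poly F} -> R) : size f = n.+1 ->
  \big[op/idx]_(d <- mdivs f) E d =
  \big[op/idx]_(k < n.+1) \big[op/idx]_(d <- monics k | d %| f) E d.
Proof. by move=> sf; rewrite big_filter sf big_monics_le. Qed.

Lemma tauE n f : size f = n.+1 ->
  tau f = (\sum_(k < n.+1) \sum_(d <- monics k | (d %| f)%R) 1)%N.
Proof. by move=> sf; rewrite -(big_mdivs _ _ sf) sum1_size. Qed.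

Definition monicize p := (lead_coef p)^-1 *: p.

Lemma monicize_monic p : p != 0 -> monicize p \is monic.
Proof.
move=> p0; rewrite monicE /monicize lead_coefZ mulVf // lead_coef_eq0 //.
Qed.

Lemma eqp_monicize p : p != 0 -> monicize p %= p.
Proof. by move=> p0; rewrite eqp_scale // invr_eq0 lead_coef_eq0. Qed.

Lemma monic_eqp p f : p \is monic -> f \is monic -> p %= f -> p = f.
Proof. by move=> mp mf; rewrite eqp_monic // => /eqP. Qed.

Lemma monic_factor f d : f \is monic -> d \is monic -> d %| f -> f %/ d \is monic.
Proof.
move=> mf md /divpK fE; rewrite -(monicMr _ md) fE //.
Qed.

(** A divisor [D] of [d * g] is the product of [gcd (D, d)] and its cofactor, which divides [g]. *)
Lemma tauM d g : d != 0 -> g != 0 -> (tau (d * g) <= tau d * tau g)%N.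
Proof.
move=> d0 g0; have dg0 : d * g != 0 by rewrite mulf_neq0.
rewrite /tau -(size_allpairs ( *%R)).
apply: uniq_leq_size => [|D]; first exact: mdivs_uniq.
rewrite mem_mdivs // => /andP[mD Ddg].
pose a := monicize (gcdp D d).
have gcd0 : gcdp D d != 0 by rewrite gcdp_eq0 (negPf d0) andbF.
have ma := monicize_monic gcd0; have ea := eqp_monicize gcd0.
have aD : a %| D by rewrite (eqp_dvdl _ ea) dvdp_gcdl.
have ad : a %| d by rewrite (eqp_dvdl _ ea) dvdp_gcdr.
apply/allpairsP; exists (a, D %/ a) => /=; split.
- by rewrite mem_mdivs // ma.
- rewrite mem_mdivs // monic_factor //=.
  have a0 : a != 0 by rewrite monic_neq0.
  have cop : coprimep (D %/ a) (d %/ a).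
    rewrite (eqp_coprimepl _ (eqp_divr _ ea)) (eqp_coprimepr _ (eqp_divr _ ea)).
    by rewrite coprimep_div_gcd // d0 orbT.
  rewrite -(Gauss_dvdpr _ cop) -(dvdp_mul2r _ _ a0) divpK //.
  by rewrite mulrAC divpK.
- by rewrite mulrC divpK.
Qed.

Lemma big_monics_dvd (R : Type) (idx : R) (op : Monoid.com_law idx) n j d
    (E : {poly F} -> R) : d \in monics j -> (j <= n)%N ->
  \big[op/idx]_(f <- monics n | d %| f) E (f %/ d) =
  \big[op/idx]_(g <- monics (n - j)) E g.
Proof.
move=> md jn; have d0 := monics_neq0 md.
rewrite -big_filter (perm_big [seq g * d | g <- monics (n - j)]) /=.
  by rewrite big_map; apply: eq_bigr => g _; rewrite mulpK.
apply: uniq_perm.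
- exact/filter_uniq/monics_uniq.
- by rewrite map_inj_uniq ?monics_uniq //; apply: mulIf.
move=> f; rewrite mem_filter; apply/andP/mapP => [[df mf]|[g mg ->]].
  exists (f %/ d); rewrite ?divpK //.
  rewrite mem_monics monic_factor ?(monics_monic mf) ?(monics_monic md) //=.
  by rewrite size_divp // (monics_size mf) (monics_size md) subSn.
by rewrite dvdp_mulIr -(subnK jn) monicsM.
Qed.

Lemma big_monics_conv (R : Type) (idx : R) (op : Monoid.com_law idx) n j
    (E : {poly F} -> {poly F} -> R) : (j <= n)%N ->
  \big[op/idx]_(f <- monics n) \big[op/idx]_(d <- monics j | d %| f) E d (f %/ d) =
  \big[op/idx]_(d <- monics j) \big[op/idx]_(g <- monics (n - j)) E d g.
Proof.
move=> jn; rewrite (exchange_big_dep xpredT) //= big_seq [RHS]big_seq.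
by apply: eq_bigr => d md; rewrite -(big_monics_dvd _ _ md jn).
Qed.

(** Induction on [e]: one factor [tau f] becomes a sum over [d %| f], and [tauM] splits the others.
    Two moments of order [e] and the choice of the degree of [d] take the power of [n.+1] from
    [2^e - 1] to [2 (2^e - 1) + 1]. *)
Lemma sum_tau_exp e n :
  (\sum_(f <- monics n) tau f ^ e <= n.+1 ^ (2 ^ e).-1 * q ^ n)%N.
Proof.
elim: e n => [|e IH] n.
  by under eq_bigr do rewrite expn0; rewrite sum1_size size_monics mul1n.
apply: (@leq_trans (\sum_(f <- monics n) \sum_(j < n.+1)
    \sum_(d <- monics j | (d %| f)%R) tau d ^ e * tau (f %/ d)%R ^ e))%N.
  rewrite big_seq [X in (_ <= X)%N]big_seq; apply: leq_sum => f mf.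
  rewrite expnS {1}(tauE (monics_size mf)) big_distrl /=; apply: leq_sum => j _.
  rewrite big_distrl /= big_seq_cond [X in (_ <= X)%N]big_seq_cond.
  apply: leq_sum => d /andP[md df]; rewrite mul1n -expnMn.
  have fE : f = d * (f %/ d) by rewrite mulrC divpK.
  have := monics_neq0 mf; rewrite {1}fE mulf_eq0 negb_or => /andP[d0 fd0].
  by case: (e) => // e'; rewrite leq_exp2r // {1}fE tauM.
rewrite exchange_big /=.
apply: (@leq_trans (\sum_(j < n.+1) n.+1 ^ (2 ^ e).-1 * n.+1 ^ (2 ^ e).-1 * q ^ n))%N.
  apply: leq_sum => j _; have jn : (j <= n)%N by rewrite -ltnS.
  rewrite (big_monics_conv _ (fun d g => tau d ^ e * tau g ^ e)%N) //=.
  have -> : (q ^ n = q ^ j * q ^ (n - j))%N by rewrite -expnD subnKC.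
  rewrite -big_distrlr /= mulnACA.
  apply: leq_mul; first apply: leq_trans (IH _) _.
    rewrite leq_mul2r; have : (j.+1 <= n.+1)%N by lia.
    by case: ((2 ^ e).-1) => [|k] h; rewrite ?expn0 ?leqnn ?orbT // leq_exp2r ?h ?orbT.
  apply: leq_trans (IH _) _; rewrite leq_mul2r.
  have : ((n - j).+1 <= n.+1)%N by lia.
  by case: ((2 ^ e).-1) => [|k] h; rewrite ?expn0 ?leqnn ?orbT // leq_exp2r ?h ?orbT.
rewrite sum_nat_const card_ord mulnA -expnD -expnS leq_mul2r.
suff -> : ((2 ^ e).-1 + (2 ^ e).-1).+1 = (2 ^ e.+1).-1 by rewrite leqnn orbT.
by rewrite expnS; have := expn_gt0 2 e; lia.
Qed.

Definition autocorrelation N b : 'rV[F]_(N + N).+1 := poly_rV (b * rev_poly N b).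

Lemma rVpoly_autocorrelation N b : b \in monics N ->
  rVpoly (autocorrelation N b) = b * rev_poly N b.
Proof.
move=> mb; rewrite poly_rV_K // size_palindromic // palindromic_mul_rev //.
by rewrite (monics_size mb).
Qed.

(* If [b R(b) = b' R(b')] then, after removing [gcd(b, b')], the cofactor of
   [b'] is the normalised reversal of the cofactor of [b]: so [b'] is
   determined by the divisor [gcd(b, b')] of [b]. *)
Lemma autocorrelation_fiber N b : b \in monics N ->
  (count (fun b' => autocorrelation N b == autocorrelation N b') (monics N) <= tau b)%N.
Proof.
move=> mb; have b0 := monics_neq0 mb; rewrite -size_filter.
pose h g := g * monicize (rev_poly (N - (size g).-1) (b %/ g)).
rewrite /tau -(size_map h (mdivs b)); apply: uniq_leq_size => [|b'].
  exact/filter_uniq/monics_uniq.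
rewrite mem_filter => /andP[/eqP /(congr1 rVpoly)].
move=> /[swap] mb'; rewrite !rVpoly_autocorrelation // => bb'.
have b'0 := monics_neq0 mb'.
have gcd0 : gcdp b b' != 0 by rewrite gcdp_eq0 (negPf b0).
pose g := monicize (gcdp b b').
have mg : g \is monic := monicize_monic gcd0; have eg := eqp_monicize gcd0.
have gb : g %| b by rewrite (eqp_dvdl _ eg) dvdp_gcdl.
have gb' : g %| b' by rewrite (eqp_dvdl _ eg) dvdp_gcdr.
have g0 : g != 0 by rewrite monic_neq0.
apply/mapP; exists g; first by rewrite mem_mdivs // mg.
pose l := (size g).-1; pose u := b %/ g; pose v := b' %/ g.
have sg : size g = l.+1 by rewrite prednK // size_poly_gt0.
have lN : (l <= N)%N.
  by rewrite -ltnS -sg -(monics_size mb); apply: dvdp_leq.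
have bE : b = g * u by rewrite mulrC divpK.
have b'E : b' = g * v by rewrite mulrC divpK.
have mu : u \is monic by rewrite monic_factor ?(monics_monic mb).
have mv : v \is monic by rewrite monic_factor ?(monics_monic mb').
have su : size u = (N - l).+1.
  by rewrite size_divp // (monics_size mb) subSn.
have sv : size v = (N - l).+1.
  by rewrite size_divp // (monics_size mb') subSn.
have cop : coprimep u v.
  rewrite (eqp_coprimepl _ (eqp_divr _ eg)) (eqp_coprimepr _ (eqp_divr _ eg)).
  by rewrite coprimep_div_gcd // b0.
have rg0 : rev_poly l g != 0.
  by apply: contraNneq g0 => z; rewrite -(@rev_polyK _ l g) ?sg // z linear0.
have uv : u * rev_poly (N - l) u = v * rev_poly (N - l) v.
  have RE (w : {poly F}) : size w = (N - l).+1 -> rev_poly N (g * w) = rev_poly l g * rev_poly (N - l) w.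
    by move=> sw; rewrite -rev_polyM ?sg ?sw // subnKC.
  apply: (mulfI (mulf_neq0 g0 rg0)); rewrite [LHS]mulrACA [RHS]mulrACA -!RE //.
  by rewrite -bE -b'E.
have ud : u %| rev_poly (N - l) v.
  by rewrite -(Gauss_dvdpr _ cop) -uv dvdp_mulr.
have rv0 : rev_poly (N - l) v != 0.
  by apply: contraNneq (monic_neq0 mv) => z; rewrite -(@rev_polyK _ (N - l) v) ?sv // z linear0.
(* A divisor of at least the same size is associate to the whole. *)
have eu : u %= rev_poly (N - l) v.
  rewrite -dvdp_size_eqp // eqn_leq (dvdp_leq rv0 ud) su.
  exact: size_rev_poly.
have /eqpP[[k1 k2] /andP[/= k10 k20] /(congr1 (rev_poly (N - l)))] := eu.
rewrite !linearZ /= rev_polyK ?sv // => kE.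
rewrite /h b'E -/l -/u; congr (_ * _).
have vE : v = (k1 / k2) *: rev_poly (N - l) u.
  by rewrite mulrC -scalerA kE scalerA mulVf // scale1r.
have ru0 : rev_poly (N - l) u != 0.
  by apply: contraNneq (monic_neq0 mv) => z; rewrite vE z scaler0.
apply: monic_eqp => //; first exact: monicize_monic.
rewrite eqp_sym (eqp_trans (eqp_monicize ru0)) // eqp_sym.
by rewrite vE eqp_scale // mulf_neq0 ?invr_eq0.
Qed.

(* Splitting over the values [s] of [sigma], each difference [D] occurs at most
   as often as the difference [0], by [2 x y <= x^2 + y^2]. *)
Lemma sum_difference_bound (T : finZmodType) (I : eqType) (r : seq I)
    (sigma : I -> T) (w : I -> nat) (Bad : {set T}) :
  (\sum_(i <- r) \sum_(j <- r | (sigma i - sigma j)%R \in Bad) w i * w j <=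
   #|Bad| * \sum_(i <- r) \sum_(j <- r | sigma i == sigma j) w i * w j)%N.
Proof.
pose v t := (\sum_(i <- r | sigma i == t) w i)%N.
have corr (D : T) : (\sum_(i <- r) \sum_(j <- r | (sigma i - sigma j)%R == D) w i * w j =
    \sum_t v (D + t)%R * v t)%N.
  under [RHS]eq_bigr do rewrite /v big_distrlr /=.
  under [RHS]eq_bigr do rewrite big_mkcond.
  rewrite [RHS]exchange_big /=; apply: eq_bigr => i _.
  rewrite (bigD1 (sigma i - D)) //= addrCA subrr addr0 eqxx [X in (_ + X)%N]big1 ?addn0.
    apply: eq_bigl => j; rewrite [in RHS]eq_sym; apply/eqP/eqP => [<-|<-].
      by rewrite opprB addrCA subrr addr0.
    by rewrite opprB addrCA subrr addr0.
  move=> t ne; case: eqP => // si; case/negP: ne; rewrite si.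
  by rewrite addrAC subrr add0r.
have corr_le D : (\sum_t v (D + t)%R * v t <= \sum_t v t * v t)%N.
  rewrite -(leq_pmul2l (ltn0Sn 1)) [X in (_ <= X)%N]mul2n -addnn.
  rewrite [X in (_ <= X + _)%N](reindex_inj (addrI D)) /= -big_split big_distrr /=.
  by apply: leq_sum => t _; rewrite !mulnn (nat_Cauchy _ _).1.
apply: (@leq_trans (\sum_(D in Bad) \sum_t v t * v t))%N; last first.
  rewrite sum_nat_const leq_mul2l; apply/orP; right.
  have := corr 0; under [X in _ = X -> _]eq_bigr do rewrite add0r.
  by move <-; under eq_bigr do under eq_bigl do rewrite subr_eq0.
apply: (@leq_trans (\sum_(D in Bad) \sum_t v (D + t)%R * v t))%N; last first.
  by apply: leq_sum => D _; apply: corr_le.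
under [X in (_ <= X)%N]eq_bigr do rewrite -corr.
rewrite exchange_big /=; apply: eq_leq; apply: eq_bigr => i _.
rewrite [RHS](exchange_big_dep xpredT) //= big_mkcond /=; apply: eq_bigr => j _.
case: ifP => h.
  rewrite (big_pred1 (sigma i - sigma j)%R) // => D /=.
  by apply/andP/eqP => [[_ /eqP ->]|->] //; rewrite h.
rewrite big1 // => D /andP[DB /eqP e]; by rewrite e DB in h.
Qed.

(** [tau b * tau b'] is at most the mean of the squares, and [b] has at most [tau b] partners with
    the same autocorrelation; this leads to the third moment of [tau], whence [7 = 2^3 - 1]. *)
Lemma autocorrelation_pairs N (Bad : {set 'rV[F]_(N + N).+1}) :
  (\sum_(b <- monics N) \sum_(b' <- monics N |
      (autocorrelation N b - autocorrelation N b')%R \in Bad) tau b * tau b'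
    <= #|Bad| * (N.+1 ^ 7 * q ^ N))%N.
Proof.
apply: leq_trans (sum_difference_bound _ _ _ _) _; rewrite leq_mul2l; apply/orP; right.
apply: leq_trans (sum_tau_exp 3 N).
set s := autocorrelation N; set r := monics N.
have sym : (\sum_(b <- r) \sum_(b' <- r | s b == s b') tau b' ^ 2 =
            \sum_(b <- r) \sum_(b' <- r | s b == s b') tau b ^ 2)%N.
  rewrite (exchange_big_dep xpredT) //=; apply: eq_bigr => b _.
  by apply: eq_bigl => b'; rewrite eq_sym.
apply: (@leq_trans (\sum_(b <- r) \sum_(b' <- r | s b == s b') tau b ^ 2))%N.
  rewrite -(leq_pmul2l (ltn0Sn 1)) [X in (_ <= X)%N]mul2n -addnn -{2}sym.
  rewrite big_distrr -big_split /=; apply: leq_sum => b _.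
  rewrite big_distrr -big_split /=; apply: leq_sum => b' _.
  by rewrite (nat_Cauchy _ _).1.
rewrite big_seq [X in (_ <= X)%N]big_seq; apply: leq_sum => b mb.
rewrite big_const_seq iter_addn_0 [X in (_ <= X)%N]expnSr leq_mul2l.
by apply/orP; right; apply: leq_trans (autocorrelation_fiber mb).
Qed.

End Divisors.

(** * Irreducible polynomials, von Mangoldt and Moebius functions *)

Section Irreducibles.
Variable F : finFieldType.
Implicit Types p f d h : {poly F}.
Local Notation q := #|F|.
Local Notation monics := (monics F).

Lemma irreducible_factor h : (1 < size h)%N ->
  exists p, [/\ p \is monic, irreducible_poly p & p %| h].
Proof.
elim/ltn_ind: {h}(size h) {-2}h (erefl (size h)) => k IH h sh k1.
case: (boolP (irreducibleb h)) => [/irreducibleP ih|].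
  have h0 := irredp_neq0 ih; exists (monicize h); rewrite monicize_monic //.
  have eh := eqp_monicize h0; rewrite (eqp_dvdl _ eh) dvdpp; split=> //.
  split; first by rewrite (eqp_size eh); case: ih.
  by move=> d sd; rewrite (eqp_dvdr _ eh) (eqp_rtrans eh); case: ih => _; apply.
move/irreducibleP => nih.
have [d [sd dh ndh]] : exists d, [/\ size d != 1%N, d %| h & ~~ (d %= h)].
  apply: contra_notP nih => nd; split; first by [].
  move=> d sd dh; apply/negPn/negP => ndh; apply: nd; by exists d.
have h0 : h != 0 by rewrite -size_poly_gt0 ltnW.
have d0 := dvdpN0 dh h0.
have sdh : (size d < k)%N.
  by rewrite ltn_neqAle -sh (dvdp_leq h0 dh) andbT; apply: contra ndh => e; rewrite -dvdp_size_eqp // sh.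
have [|p [mp ip pd]] := IH _ sdh d (erefl _).
  by rewrite ltn_neqAle eq_sym sd size_poly_gt0.
by exists p; rewrite (dvdp_trans pd dh).
Qed.

Lemma irredp_size_gt1 p : irreducible_poly p -> (1 < size p)%N.
Proof. by case. Qed.

Lemma irredp_monic_dvd p p' : p \is monic -> p' \is monic ->
  irreducible_poly p -> irreducible_poly p' -> (p %| p') = (p == p').
Proof.
move=> mp mp' ip ip'; apply/idP/eqP => [pp'|->]; last exact: dvdpp.
apply: monic_eqp => //; case: ip' => _ -> //.
by rewrite gtn_eqF // irredp_size_gt1.
Qed.

Lemma irredp_coprime p p' : p \is monic -> p' \is monic ->
  irreducible_poly p -> irreducible_poly p' -> p != p' -> coprimep p p'.
Proof.
move=> mp mp' ip ip' pp'; rewrite (irreducible_poly_coprime _ ip).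
by rewrite irredp_monic_dvd.
Qed.

Variable n : nat.

Definition irrs := [seq p <- monics_le F n | irreducibleb p].

Lemma irrsP p : reflect [/\ p \is monic, irreducible_poly p & (size p <= n.+1)%N] (p \in irrs).
Proof.
rewrite mem_filter mem_monics_le.
apply: (iffP and3P) => [[/irreducibleP ? ? ?]|[? ? ?]]; split=> //.
exact/irreducibleP.
Qed.

Lemma irrs_uniq : uniq irrs.
Proof. exact/filter_uniq/monics_le_uniq. Qed.

Lemma irrs_factor h : h \is monic -> (1 < size h <= n.+1)%N ->
  exists2 p, p \in irrs & p %| h.
Proof.
move=> mh /andP[s1 sn]; have [p [mp ip ph]] := irreducible_factor s1.
exists p => //; apply/irrsP; split=> //.
by apply: leq_trans sn; apply: dvdp_leq => //; apply: monic_neq0.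
Qed.

(* [mangoldt] and [moebius] are the classical functions only on polynomials of
   degree at most [n]. *)
Definition mangoldt f : nat :=
  (\sum_(p <- irrs) \sum_(1 <= i < n.+1) ((p ^+ i)%R == f) * (size p).-1)%N.

(** The degree is counted by irreducible factors with multiplicity. Removing one factor [p0] changes
    only the terms of [p0], by [deg p0]. *)
Lemma sum_irreducible_powers h : h \is monic -> (size h <= n.+1)%N ->
  (\sum_(p <- irrs) \sum_(1 <= i < n.+1) (p ^+ i %| h)%R * (size p).-1 = (size h).-1)%N.
Proof.
elim/ltn_ind: {h}(size h) {-2}h (erefl (size h)) => k IH h sh mh hn.
have h0 := monic_neq0 mh; rewrite -sh in IH hn *.
have [h1|s1] := leqP (size h) 1.
  have sh1 : size h = 1%N by apply/eqP; rewrite eqn_leq h1 size_poly_gt0.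
  rewrite sh1 big_seq big1 // => p /irrsP[mp ip _].
  rewrite big_nat_cond big1 // => i /andP[/andP[i0 _] _].
  case: (boolP (p ^+ i %| h)) => // /(dvdp_leq h0).
  rewrite sh1 leqNgt; case/negP; rewrite -(prednK i0) exprS.
  rewrite size_monicM ?monic_neq0 ?monic_exp //.
  have := irredp_size_gt1 ip; have : (0 < size (p ^+ i.-1))%N.
    by rewrite size_poly_gt0 monic_neq0 // monic_exp.
  by move: (size p) (size (p ^+ _)) => a b; lia.
have [|p0 p0irr p0h] := irrs_factor mh; first by rewrite s1.
have /irrsP[mp0 ip0 _] := p0irr; have p00 := monic_neq0 mp0.
pose h' := h %/ p0.
have hE : h = p0 * h' by rewrite mulrC divpK.
have mh' : h' \is monic by apply: monic_factor.
have h'0 := monic_neq0 mh'.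
have shE : size h = ((size p0).-1 + size h')%N.
  by rewrite hE size_monicM //; have := irredp_size_gt1 ip0; move: (size p0) (size h') => a b; lia.
have sp0 := irredp_size_gt1 ip0.
have sh' : (size h' < size h)%N by rewrite shE; move: sp0; move: (size p0) (size h') => a b; lia.
have := IH _ sh' h' (erefl _) mh' (leq_trans (ltnW sh') hn).
rewrite !(bigD1_seq p0) //=; try exact: irrs_uniq.
have -> : (\sum_(p <- irrs | p != p0) \sum_(1 <= i < n.+1) (p ^+ i %| h)%R * (size p).-1 =
    \sum_(p <- irrs | p != p0) \sum_(1 <= i < n.+1) (p ^+ i %| h')%R * (size p).-1)%N.
  rewrite big_seq_cond [RHS]big_seq_cond.
  apply: eq_bigr => p /andP[/irrsP[mp ip _] pp0]; apply: eq_bigr => i _.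
  rewrite hE Gauss_dvdpr // coprimep_expl //; exact: irredp_coprime.
have n0 : (0 < n)%N by move: (leq_trans s1 hn); rewrite ltnS.
(* Exponent [i + 1] for [h] corresponds to [i] for [h']; the left-over exponent [n] contributes
   nothing, since [deg h' < n]. *)
have -> : (\sum_(1 <= i < n.+1) (p0 ^+ i %| h)%R * (size p0).-1 =
   (size p0).-1 + \sum_(1 <= i < n.+1) (p0 ^+ i %| h')%R * (size p0).-1)%N.
  rewrite -(prednK n0) [in RHS]big_nat_recr //= (prednK n0).
  rewrite (_ : (p0 ^+ n %| h') = false) ?addn0; last first.
    apply/negP => /(dvdp_leq h'0); have := size_exp p0 n.
    have /leq_trans/(_ hn) := sh'; move: sp0.
    by move: (size p0) (size h') (size (p0 ^+ n)) => a b c; nia.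
  rewrite big_add1 /= big_ltn // expr1 p0h mul1n; congr addn.
  apply: eq_bigr => i _.
  by rewrite hE exprS dvdp_mul2l.
by rewrite -addnA => ->; rewrite shE; move: h'0; rewrite -size_poly_gt0; move: (size p0) (size h') => a b; lia.
Qed.

(** The analogue of the classical divisor sum of von Mangoldt's function, with degree in place of
    the logarithm. *)
Lemma sum_mangoldt h : h \is monic -> (size h <= n.+1)%N ->
  (\sum_(e <- mdivs h) mangoldt e = (size h).-1)%N.
Proof.
move=> mh hn; rewrite -(sum_irreducible_powers mh hn) /mangoldt.
rewrite exchange_big /= big_seq [RHS]big_seq; apply: eq_bigr => p /irrsP[mp _ _].
rewrite exchange_big /=; apply: eq_bigr => i _.
rewrite -big_distrl /=; congr (_ * _)%N.
have := mem_mdivs (p ^+ i) (monic_neq0 mh); rewrite monic_exp //= => <-.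
rewrite -(count_uniq_mem _ (mdivs_uniq h)) -sum1_count [RHS]big_mkcond /=.
by apply: eq_bigr => e _; rewrite eq_sym; case: eqP.
Qed.

Lemma mangoldt_le f : f \is monic -> (size f <= n.+1)%N ->
  (mangoldt f <= (size f).-1)%N.
Proof.
move=> mf fn; rewrite -(sum_mangoldt mf fn) (bigD1_seq f) ?mdivs_uniq ?leq_addr //=.
by rewrite mem_mdivs ?monic_neq0 // mf dvdpp.
Qed.

Lemma mangoldt_irreducible f : f \in monics n -> irreducible_poly f -> mangoldt f = n.
Proof.
move=> mf irf; have sf := monics_size mf; have mo := monics_monic mf.
have n0 : (0 < n)%N by have := irredp_size_gt1 irf; rewrite sf.
apply/eqP; rewrite eqn_leq; apply/andP; split.
  by have := mangoldt_le mo; rewrite sf; apply.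
rewrite /mangoldt (bigD1_seq f) ?irrs_uniq //=; last first.
  by apply/irrsP; split; rewrite ?sf.
by rewrite big_ltn ?ltnS // expr1 eqxx mul1n sf /= -addnA leq_addr.
Qed.

(* Proper powers [p^i] of degree [n] have [deg p <= n / 2]. *)
Lemma sum_mangoldt_reducible :
  (\sum_(f <- monics n | ~~ irreducibleb f) mangoldt f <= n.+1 ^ 3 * q ^ n./2)%N.
Proof.
apply: (@leq_trans (\sum_(p <- monics_le F n) \sum_(1 <= i < n.+1)
    ((size p).-1 <= n./2)%N * n))%N; last first.
  rewrite big_monics_le /=.
  apply: (@leq_trans (\sum_(k < n.+1) n.+1 ^ 2 * q ^ n./2))%N; last first.
    by rewrite sum_nat_const card_ord mulnA -expnS.
  apply: leq_sum => k _.
  apply: (@leq_trans (\sum_(p <- monics k) n * ((k <= n./2) * n)))%N.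
    rewrite big_seq [X in (_ <= X)%N]big_seq; apply: leq_sum => p mp.
    by rewrite sum_nat_const_nat subn1 (monics_size mp).
  rewrite big_const_seq count_predT size_monics iter_addn_0.
  case: (leqP k n./2) => kn; last by rewrite /= mul0n muln0.
  rewrite /= mul1n.
  apply: leq_mul; first by rewrite -mulnn leq_mul.
  by rewrite leq_exp2l // finNzRing_gt1.
rewrite /mangoldt (exchange_big_dep xpredT) //= big_filter.
rewrite big_mkcond /= big_seq [X in (_ <= X)%N]big_seq; apply: leq_sum => p.
rewrite mem_monics_le => /andP[mp sp]; case: ifP => // /irreducibleP ip.
rewrite (exchange_big_dep xpredT) //= big_nat_cond [X in (_ <= X)%N]big_nat_cond.
apply: leq_sum => i /andP[/andP[i0 _] _].
(* Each pair [(p, i)] meets only [f = p^i], and reducibility of [f] forces [i > 1]. *)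
case: (boolP [&& p ^+ i \in monics n & ~~ irreducibleb (p ^+ i)]) => [/andP[pn pnirr]|h]; last first.
  rewrite big_seq_cond big1 // => f /andP[mf nif]; case: eqP => // e.
  by move: nif; rewrite !andbT => nif; rewrite e mf nif in h.
have i1 : (1 < i)%N.
  rewrite ltn_neqAle i0 andbT; apply: contraNneq pnirr => <-; rewrite expr1.
  exact/irreducibleP.
have si : ((size p).-1 * i = n)%N by rewrite -size_exp (monics_size pn).
have -> : ((size p).-1 <= n./2)%N by rewrite -si geq_half_double -muln2 leq_mul2l i1 orbT.
rewrite mul1n -big_distrl /=.
apply: (@leq_trans (1 * (size p).-1))%N; last by rewrite mul1n -[X in (_ <= X)%N]si leq_pmulr.
rewrite leq_mul2r; apply/orP; right; rewrite big_mkcond /=.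
apply: (@leq_trans (\sum_(f <- monics n) (f == (p ^+ i)%R)))%N.
  by apply: leq_sum => f _; rewrite eq_sym; case: ifP.
rewrite -big_mkcond /= sum1_count (count_uniq_mem _ (monics_uniq _ _)).
by case: (_ \in _).
Qed.

Definition moebius d : algC :=
  \prod_(p <- irrs) (if p ^+ 2 %| d then 0 else if p %| d then -1 else 1).

Lemma norm_moebius d : `|moebius d| <= 1.
Proof.
rewrite /moebius; elim/big_ind: _ => [|x y hx hy|p _]; first by rewrite normr1.
  by rewrite normrM mulr_ile1.
by case: ifP; rewrite ?normr0 ?ler01 //; case: ifP; rewrite ?normrN normr1.
Qed.

Lemma moebius1 : moebius 1 = 1.
Proof.
rewrite /moebius big_seq big1 // => p /irrsP[mp ip _].
have s1 := irredp_size_gt1 ip.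
have -> : (p %| 1) = false by rewrite dvdp1 gtn_eqF.
case: ifP => // /(dvdp_trans (dvdp_exp2l p (isT : 1 <= 2)%N)).
by rewrite expr1 dvdp1 gtn_eqF.
Qed.

Lemma moebius_irreducibleM p d : p \in irrs -> ~~ (p %| d) -> d != 0 ->
  moebius (p * d) = - moebius d.
Proof.
move=> pirr pd d0; have /irrsP[mp ip _] := pirr.
rewrite /moebius !(bigD1_seq p) ?irrs_uniq //=.
rewrite expr2 dvdp_mul2l ?monic_neq0 // (negPf pd) dvdp_mulr //.
have -> : (p * p %| d) = false.
  by apply: contraNF pd; apply: dvdp_trans; apply: dvdp_mulr.
rewrite mulN1r mul1r; congr (- _).
rewrite big_seq_cond [RHS]big_seq_cond; apply: eq_bigr => r /andP[/irrsP[mr ir _] rp].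
have cop := irredp_coprime mr mp ir ip rp.
by rewrite !Gauss_dvdpr // coprimep_expl.
Qed.

(** Fix an irreducible [p] dividing [h]. Divisors divisible by [p^2] contribute 0, and the others
    cancel in pairs [d], [p * d]. *)
Lemma sum_moebius h : h \is monic -> (1 < size h <= n.+1)%N ->
  \sum_(d <- mdivs h) moebius d = 0.
Proof.
move=> mh sh; have h0 := monic_neq0 mh.
have [p pirr ph] := irrs_factor mh sh; have /irrsP[mp ip _] := pirr.
have p0 := monic_neq0 mp.
rewrite (bigID (fun d => p %| d)) /= (bigID (fun d => p ^+ 2 %| d)) /=.
rewrite big1 ?add0r => [|d /andP[_ ppd]]; last first.
  by rewrite /moebius (bigD1_seq p) ?irrs_uniq //= ppd mul0r.
rewrite -big_filter (perm_big [seq p * d | d <- mdivs h & ~~ (p %| d)]).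
  rewrite big_map big_filter -big_split /= big_seq_cond big1 // => d /andP[].
  rewrite mem_mdivs // => /andP[md _] pd.
  by rewrite (moebius_irreducibleM pirr pd (monic_neq0 md)) addNr.
apply: uniq_perm; first exact/filter_uniq/mdivs_uniq.
  rewrite (map_inj_uniq (mulfI p0)); exact/filter_uniq/mdivs_uniq.
move=> d; rewrite mem_filter mem_mdivs //.
apply/idP/mapP => [/andP[/andP[pd ppd] /andP[md dh]]|[d']].
  exists (d %/ p); last by rewrite mulrC divpK.
  rewrite mem_filter mem_mdivs // monic_factor //=.
  rewrite (dvdp_trans _ dh) ?divp_dvd // andbT.
  by apply: contra ppd => h1; rewrite expr2 -(divpK pd) dvdp_mul2r.
rewrite mem_filter mem_mdivs // => /and3P[pd' md' d'h] ->.
rewrite dvdp_mulr // expr2 dvdp_mul2l // pd' monicMl // md' /=.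
by rewrite Gauss_dvdp ?ph // irreducible_poly_coprime.
Qed.

End Irreducibles.

(** * Elementary bounds for squared moduli of sums *)

Lemma norm_sum_sqr (I : eqType) (r : seq I) (z : I -> algC) (Z : algC) :
    (forall i, i \in r -> `|z i| ^+ 2 <= Z) ->
  `|\sum_(i <- r) z i| ^+ 2 <= (size r)%:R ^+ 2 * Z.
Proof.
move=> zZ; have := CauchySchwarz_seq r (fun=> 1) z.
under eq_bigr do rewrite mul1r; move/le_trans; apply.
rewrite normr1 expr1n big_const_seq count_predT iter_addr_0 expr2 -mulrA.
rewrite ler_wpM2l ?ler0n // mulr_natl -[X in _ <= X]addr0 -iter_addr.
rewrite -[X in iter X]count_predT -big_const_seq big_seq [X in _ <= X]big_seq.
exact: ler_sum.
Qed.

Lemma norm_sum_sqr_ord k (z : 'I_k -> algC) (Z : algC) :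
    (forall i, `|z i| ^+ 2 <= Z) -> `|\sum_(i < k) z i| ^+ 2 <= k%:R ^+ 2 * Z.
Proof.
move=> zZ; have := @norm_sum_sqr _ (index_enum 'I_k) z Z (fun i _ => zZ i).
by rewrite -sum1_size sum_nat_const card_ord muln1.
Qed.

Lemma norm_sub_sqr (x y X Y : algC) : `|x| ^+ 2 <= X -> `|y| ^+ 2 <= Y ->
  `|x - y| ^+ 2 <= 2 * (X + Y).
Proof.
move=> hx hy; apply: le_trans (_ : (`|x| + `|y|) ^+ 2 <= _).
  by rewrite lerXn2r ?nnegrE ?addr_ge0 // ler_normB.
apply: le_trans (_ : 2 * (`|x| ^+ 2 + `|y| ^+ 2) <= _); last first.
  by rewrite ler_pM2l // lerD.
rewrite -subr_ge0 (_ : _ - _ = (`|x| - `|y|) ^+ 2); last by ring.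
by rewrite real_exprn_even_ge0 // rpredB // normr_real.
Qed.

Lemma sum_ord_trunc (V : nmodType) k a (X : nat -> V) : (k < a)%N ->
  (forall j, (k < j)%N -> X j = 0) -> \sum_(j < a) X j = \sum_(j < k.+1) X j.
Proof.
move=> ka X0; rewrite -!(big_mkord xpredT X) (@big_cat_nat _ _ _ k.+1) //=.
rewrite [X in _ + X]big_nat_cond [X in _ + X]big1 ?addr0 // => j.
by rewrite andbT => /andP[kj _]; apply: X0.
Qed.

(** * Vaughan's identity for monic polynomials of degree [n] *)

Section Vaughan.
Variables (F : finFieldType) (n U : nat).
Implicit Types f d e h g : {poly F}.
Local Notation q := #|F|.
Local Notation monics := (monics F).
Local Notation mu := (moebius n).
Local Notation La := (mangoldt n).

Lemma monics0 h : h \in monics 0 -> h = 1.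
Proof.
move=> mh; apply: monic_eqp; rewrite ?monic1 ?(monics_monic mh) //.
by rewrite -size_poly_eq1 (monics_size mh).
Qed.

Lemma monics_dvd_gt (V : nmodType) k j h (E : {poly F} -> V) :
  h \in monics k -> (k < j)%N -> \sum_(d <- monics j | d %| h) E d = 0.
Proof.
move=> mh kj; rewrite big_seq_cond big1 // => d /andP[md dh].
have := dvdp_leq (monics_neq0 mh) dh; rewrite (monics_size mh) (monics_size md).
by rewrite ltnS leqNgt kj.
Qed.

Lemma sum_dvd_monics (V : nmodType) k a h (E : {poly F} -> V) :
    h \in monics k -> (k < a)%N ->
  \sum_(j < a) \sum_(d <- monics j | d %| h) E d = \sum_(d <- mdivs h) E d.
Proof.
move=> mh ka; rewrite (big_mdivs _ _ (monics_size mh)).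
apply: (sum_ord_trunc (X := fun j => \sum_(d <- monics j | d %| h) E d)) => // j kj.
exact: monics_dvd_gt mh kj.
Qed.

(** Cutting the divisor sum of [mu] at degree [U] leaves its values unchanged up to degree [U]: 1 at
    degree 0, and 0 at positive degrees, by [sum_moebius]. *)
Definition trunc_moebius h : algC :=
  \sum_(j < U.+1) \sum_(d <- monics j | d %| h) mu d.

Lemma trunc_moebius0 k h : h \in monics k -> (0 < k <= U)%N -> (k <= n)%N ->
  trunc_moebius h = 0.
Proof.
move=> mh /andP[k0 kU] kn; rewrite /trunc_moebius (sum_dvd_monics _ mh) //.
by apply: sum_moebius; rewrite ?(monics_monic mh) // (monics_size mh) !ltnS k0.
Qed.

Lemma trunc_moebius1 h : h \in monics 0 -> trunc_moebius h = 1.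
Proof.
move=> mh; rewrite /trunc_moebius (sum_dvd_monics _ mh) //.
rewrite (monics0 mh) (bigD1_seq 1) ?mdivs_uniq ?mem_mdivs ?oner_eq0 ?monic1 ?dvdpp //=.
rewrite moebius1 big_seq_cond big1 ?addr0 // => d.
rewrite mem_mdivs ?oner_eq0 // => /andP[/andP[md d1] /negP[]].
by rewrite (@monic_eqp _ d 1) ?monic1 // -size_poly_eq1 -dvdp1.
Qed.

Lemma norm_trunc_moebius k h : h \in monics k -> `|trunc_moebius h| <= (tau h)%:R.
Proof.
move=> mh; apply: (@le_trans _ _ (\sum_(j < U.+1) \sum_(d <- monics j | d %| h) 1)).
  apply: le_trans (ler_norm_sum _ _ _) _; apply: ler_sum => j _.
  apply: le_trans (ler_norm_sum _ _ _) _; apply: ler_sum => d _.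
  exact: norm_moebius.
apply: (@le_trans _ _ (\sum_(j < (U + k).+1) \sum_(d <- monics j | d %| h) 1)).
  rewrite -!(big_mkord xpredT (fun j => \sum_(d <- monics j | d %| h) 1)).
  rewrite [X in _ <= X](@big_cat_nat _ _ _ U.+1) //=; last by rewrite ltnS leq_addr.
  by rewrite lerDl; apply: sumr_ge0 => j _; apply: sumr_ge0.
rewrite (sum_dvd_monics _ mh) ?ltnS ?leq_addl //.
by rewrite big_const_seq count_predT iter_addr_0.
Qed.

Variable w : {poly F} -> algC.

Definition vaughan_term k : algC :=
  \sum_(e <- monics k) \sum_(h <- monics (n - k))
    (La e)%:R * trunc_moebius h * w (e * h).

(** Both sides sum [mu d * La e] over [d * e] dividing [f] with [deg d <= U]; summing over [e] first
    gives [deg (f / d) = n - j]. *)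
Lemma vaughan_pointwise f : f \in monics n ->
  \sum_(k < n.+1) \sum_(e <- monics k | e %| f) (La e)%:R * trunc_moebius (f %/ e) =
  \sum_(j < U.+1) \sum_(d <- monics j | d %| f) mu d * (n - j)%:R.
Proof.
move=> mf.
have swap d e : d != 0 -> e != 0 ->
    (e %| f) && (d %| f %/ e) = (d %| f) && (e %| f %/ d).
  move=> d0 e0; have half a b : a != 0 -> (a %| f) && (b %| f %/ a) = (b * a %| f).
    move=> a0; apply/andP/idP => [[af bfa]|baf].
      by rewrite -(divpK af) dvdp_mul2r.
    have af : a %| f by apply: dvdp_trans baf; apply: dvdp_mulIr.
    by rewrite af -(dvdp_mul2r _ _ a0) divpK.
  by rewrite !half // mulrC.
transitivity (\sum_(k < n.+1) \sum_(e <- monics k) \sum_(j < U.+1) \sum_(d <- monics j)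
    if (d %| f) && (e %| f %/ d) then mu d * (La e)%:R else 0).
  apply: eq_bigr => k _; rewrite big_mkcond /= big_seq [RHS]big_seq; apply: eq_bigr => e me.
  have e0 := monics_neq0 me; case: ifP => ef; last first.
    rewrite big1 // => j _; rewrite big_seq big1 // => d md.
    by rewrite -swap ?ef // (monics_neq0 md).
  rewrite /trunc_moebius mulr_sumr; apply: eq_bigr => j _.
  rewrite big_mkcond mulr_sumr /= big_seq [RHS]big_seq; apply: eq_bigr => d md.
  rewrite -swap ?(monics_neq0 md) // ef /=; case: ifP => _; rewrite ?mulr0 //.
  by rewrite mulrC.
under eq_bigr do rewrite exchange_big /=.
rewrite exchange_big /=; apply: eq_bigr => j _.
under eq_bigr do rewrite exchange_big /=.
rewrite exchange_big /= [RHS]big_mkcond big_seq [RHS]big_seq; apply: eq_bigr => d md.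
case: ifP => df; last by rewrite big1 // => k _; rewrite big1.
have jn : (j <= n)%N.
  by have := dvdp_leq (monics_neq0 mf) df; rewrite (monics_size mf) (monics_size md) ltnS.
have mfd : f %/ d \in monics (n - j).
  rewrite mem_monics monic_factor ?(monics_monic mf) ?(monics_monic md) //=.
  by rewrite size_divp ?(monics_neq0 md) // (monics_size mf) (monics_size md) subSn.
under eq_bigr do rewrite -big_mkcond -mulr_sumr /=.
rewrite -mulr_sumr; congr (_ * _).
rewrite (sum_dvd_monics _ mfd) ?ltnS ?leq_subr // -natr_sum sum_mangoldt //.
- by rewrite (monics_size mfd).
- exact: monics_monic mfd.
- by rewrite (monics_size mfd) ltnS leq_subr.
Qed.

(** The term [k = n], where [h = 1], is the sum on the left. The degree [k] of [e] is not cut here: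
    small [k] is separated later, as a type I sum. *)
Lemma vaughan_identity : (U < n)%N ->
  \sum_(f <- monics n) (La f)%:R * w f =
  \sum_(j < U.+1) \sum_(d <- monics j) \sum_(g <- monics (n - j))
     mu d * (n - j)%:R * w (d * g) - \sum_(k < n) vaughan_term k.
Proof.
move=> Un; apply/eqP; rewrite eq_sym subr_eq addrC; apply/eqP.
transitivity (\sum_(f <- monics n) (\sum_(j < U.+1) \sum_(d <- monics j | d %| f) mu d * (n - j)%:R) * w f).
  under [RHS]eq_bigr do rewrite mulr_suml.
  rewrite [RHS]exchange_big /=; apply: eq_bigr => j _.
  have jn : (j <= n)%N by have := ltn_ord j; lia.
  rewrite -(big_monics_conv _ (fun d g => mu d * (n - j)%:R * w (d * g)) jn) /=.
  apply: eq_bigr => f _; rewrite mulr_suml; apply: eq_bigr => d df.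
  by rewrite [d * _]mulrC divpK.
transitivity (\sum_(k < n.+1) vaughan_term k); last first.
  rewrite big_ord_recr /=; congr (_ + _); rewrite /vaughan_term subnn.
  apply: eq_bigr => f _; rewrite big_seq (eq_bigr (fun _ => (La f)%:R * w f)); last first.
    move=> h mh; rewrite trunc_moebius1 // mulr1.
    by rewrite (monics0 mh) mulr1.
  by rewrite -big_seq big_const_seq count_predT size_monics expn0 /= addr0.
rewrite big_seq; under eq_bigr => f mf do rewrite -(vaughan_pointwise mf) mulr_suml.
rewrite -big_seq exchange_big /=; apply: eq_bigr => k _.
have kn : (k <= n)%N by rewrite -ltnS.
rewrite /vaughan_term -(big_monics_conv _ (fun e h => (La e)%:R * trunc_moebius h * w (e * h)) kn) /=.
apply: eq_bigr => f _; rewrite mulr_suml; apply: eq_bigr => e ef.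
by rewrite [e * _]mulrC divpK.
Qed.

End Vaughan.

(** * Type I and type II sums *)

Section ExponentialSums.
Variables (F : finFieldType) (m : nat) (c : 'I_m.+1 -> F) (psi : F -> algC).
Hypotheses (two_neq0 : (2 : F) != 0) (cm : c ord_max != 0).
Hypothesis psiP : additive_character psi.
Variables (n : nat) (ell : {poly F} -> F).
Hypothesis ellD : {morph ell : x y / x + y}.
Local Notation q := #|F|.
Local Notation monics := (monics F).
Local Notation A := (symbol c).

Let q1 : (1 < q)%N := finNzRing_gt1 F.

Definition phase (f : {poly F}) : F :=
  2^-1 * (A * (f * rev_poly n f))`_(n + m) + ell f.

Local Notation w := (fun f => psi (phase f)).

Lemma phaseM N K b a : (N + K)%N = n -> b \in monics N -> a \in monics K ->
  phase (b * a) =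
  2^-1 * (A * (b * rev_poly N b) * (a * rev_poly K a))`_(N + m + K) + ell (b * a).
Proof.
move=> NK mb ma; rewrite /phase -NK rev_polyM ?(monics_size mb) ?(monics_size ma) //.
by rewrite [(N + K + m)%N]addnAC [b * a * _]mulrACA !mulrA.
Qed.

Lemma palindromic_symbolM N (S : {poly F}) : palindromic N S -> palindromic (N + m) (A * S).
Proof. by move=> pS; rewrite addnC palindromicM ?palindromic_symbol. Qed.

Lemma monics_autocorrelation N b : b \in monics N -> palindromic N (b * rev_poly N b).
Proof. by move=> mb; rewrite palindromic_mul_rev // (monics_size mb). Qed.

(** The symbol is [A] times the nonzero palindromic [b * rev_poly N b], so its kernel has at most
    [q ^ (N + m)] elements. *)
Lemma type1_bound N K b : (N + K)%N = n -> b \in monics N ->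
  `|\sum_(g <- monics K) w (b * g)| ^+ 2 <= (q ^ (n + m))%:R.
Proof.
move=> NK mb; have pb := monics_autocorrelation mb.
have lD : {morph (fun a => ell (b * a)) : x y / x + y}.
  by move=> x y; rewrite mulrDr ellD.
have := quadratic_sum_bound two_neq0 K psiP (palindromic_symbolM pb) lD.
rewrite (eq_big_seq (fun g => w (b * g))) /= => [|a ma]; last by rewrite (phaseM NK mb ma).
move/le_trans; apply.
rewrite ler_nat; have -> : (n + m = K + (N + m))%N by lia.
rewrite expnD leq_mul2l; apply/orP; right.
apply: symbol_ker_card => //; apply: mulf_neq0; first exact: monics_neq0 mb.
apply: contraNneq (monics_neq0 mb) => z.
by rewrite -(@rev_polyK _ N b) ?(monics_size mb) // z linear0.
Qed.

(** Conjugation subtracts phases, so the summand is again a quadratic phase in [a], with symbol [A]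
    times the difference of autocorrelations. *)
Lemma pair_bound N K b b' : (N + K)%N = n -> b \in monics N -> b' \in monics N ->
  `|\sum_(a <- monics K) w (b * a) * (w (b' * a))^*| ^+ 2 <=
  (q ^ K * #|toeplitz_ker (N + m) K
     (A * rVpoly (autocorrelation N b - autocorrelation N b'))|)%:R.
Proof.
move=> NK mb mb'; rewrite linearB /= !rVpoly_autocorrelation //.
have pD : palindromic N (b * rev_poly N b - b' * rev_poly N b').
  by rewrite palindromicB ?monics_autocorrelation.
have lD : {morph (fun a => ell (b * a) - ell (b' * a)) : x y / x + y}.
  by move=> x y; rewrite !mulrDr !ellD opprD addrACA.
have := quadratic_sum_bound two_neq0 K psiP (palindromic_symbolM pD) lD.
rewrite (eq_big_seq (fun a => w (b * a) * (w (b' * a))^*)) //= => a ma.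
rewrite -psiN // -psiD // !(phaseM NK _ ma) // [A * (_ - _)]mulrBr [(_ - _) * (a * _)]mulrBl coefB.
congr psi; rewrite mulrBr; ring.
Qed.

Lemma pair_bound_trivial K b b' :
  `|\sum_(a <- monics K) w (b * a) * (w (b' * a))^*| <= (q ^ K)%:R.
Proof.
apply: le_trans (ler_norm_sum _ _ _) _.
under eq_bigr do rewrite normrM norm_conjC !norm_psi // mulr1.
by rewrite big_const_seq count_predT iter_addr_0 size_monics.
Qed.

(** Outside the bad set the kernel has at most [q ^ (K - rho.*2)] elements; the square root halves
    the saving. *)
Lemma pair_bound_good N K rho b b' : (N + K)%N = n -> (rho.*2 <= K)%N ->
    b \in monics N -> b' \in monics N ->
    autocorrelation N b - autocorrelation N b' \notin bad_symbols c N K rho.*2 ->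
  `|\sum_(a <- monics K) w (b * a) * (w (b' * a))^*| <= (q ^ (K - rho))%:R.
Proof.
move=> NK rK mb mb'; rewrite inE linearB /= palindromicB; last 2 first.
- by rewrite rVpoly_autocorrelation // monics_autocorrelation.
- by rewrite rVpoly_autocorrelation // monics_autocorrelation.
rewrite -leqNgt -linearB /= => ker.
rewrite -(@ler_pXn2r _ 2) ?nnegrE ?normr_ge0 ?ler0n //.
apply: le_trans (pair_bound NK mb mb') _; rewrite -natrX ler_nat.
apply: leq_trans (leq_mul (leqnn _) ker) _.
rewrite -expnD -expnM leq_exp2l //; lia.
Qed.

(** Good pairs save [q ^ rho], with weights adding up to at most the square of the first moment of
    [tau]; bad pairs are bounded trivially and counted by [autocorrelation_pairs]. *)
Lemma pair_sum_bound N K rho : (N + K)%N = n -> (rho.*2 <= K)%N ->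
  \sum_(b <- monics N) \sum_(b' <- monics N) (tau b * tau b')%:R *
      `|\sum_(a <- monics K) w (b * a) * (w (b' * a))^*|
  <= (q ^ (K - rho) * (N.+1 * q ^ N) ^ 2 +
      q ^ K * (#|bad_symbols c N K rho.*2| * (N.+1 ^ 7 * q ^ N)))%:R.
Proof.
move=> NK rK; set Bad := bad_symbols _ _ _ _.
apply: (@le_trans _ _ (\sum_(b <- monics N) \sum_(b' <- monics N)
   (tau b * tau b' * q ^ (K - rho) + (autocorrelation N b - autocorrelation N b' \in Bad)%R *
    (tau b * tau b' * q ^ K))%:R)).
  rewrite big_seq [X in _ <= X]big_seq; apply: ler_sum => b mb.
  rewrite big_seq [X in _ <= X]big_seq; apply: ler_sum => b' mb'.
  rewrite natrD; case: (boolP (_ \in Bad)) => bad.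
    rewrite mul1n ler_wpDl ?ler0n // [X in _ <= X]natrM.
    by rewrite ler_wpM2l ?ler0n // pair_bound_trivial.
  by rewrite mul0n addr0 [X in _ <= X]natrM ler_wpM2l ?ler0n // (pair_bound_good NK).
under eq_bigr do rewrite -natr_sum; rewrite -natr_sum ler_nat.
under eq_bigr do rewrite big_split /=; rewrite big_split /=; apply: leq_add.
  under eq_bigr do rewrite -big_distrl /=.
  rewrite -big_distrl /= mulnC leq_mul2l; apply/orP; right.
  under eq_bigr do rewrite -big_distrr /=.
  rewrite -big_distrl /= mulnn leq_exp2r //.
  have := sum_tau_exp F 1 N; rewrite expn1.
  by under eq_bigr do rewrite expn1.
under eq_bigr do under eq_bigr do rewrite mulnA.
under eq_bigr do rewrite -big_distrl /=.
rewrite -big_distrl /= mulnC leq_mul2l; apply/orP; right.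
apply: leq_trans (autocorrelation_pairs Bad).
apply: leq_sum => b _; rewrite [X in (_ <= X)%N]big_mkcond; apply: leq_sum => b' _.
by case: ifP => _; rewrite ?mul1n.
Qed.

(** Cauchy-Schwarz over [a] removes [alpha] at the cost of a second moment of [tau]; opening the
    square leaves sums over [a] for pairs [b], [b']. *)
Lemma type2_bound N K rho (C D : nat) (alpha beta : {poly F} -> algC) :
    (N + K)%N = n -> (rho.*2 <= K)%N ->
    (forall a, a \in monics K -> `|alpha a| <= (C * tau a)%:R) ->
    (forall b, b \in monics N -> `|beta b| <= (D * tau b)%:R) ->
  `|\sum_(b <- monics N) \sum_(a <- monics K) beta b * alpha a * w (b * a)| ^+ 2 <=
  (C ^ 2 * (K.+1 ^ 3 * q ^ K) * (D ^ 2 * (q ^ (K - rho) * (N.+1 * q ^ N) ^ 2 +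
      q ^ K * (#|bad_symbols c N K rho.*2| * (N.+1 ^ 7 * q ^ N)))))%:R.
Proof.
move=> NK rK hal hbe; rewrite exchange_big /=.
have -> : \sum_(a <- monics K) \sum_(b <- monics N) beta b * alpha a * w (b * a) =
          \sum_(a <- monics K) alpha a * \sum_(b <- monics N) beta b * w (b * a).
  apply: eq_bigr => a _; rewrite mulr_sumr; apply: eq_bigr => b _.
  by rewrite [beta b * _]mulrC mulrA.
apply: le_trans (CauchySchwarz_seq _ _ _) _.
rewrite natrM; apply: ler_pM; try by apply: sumr_ge0 => a _; rewrite exprn_ge0.
  apply: (@le_trans _ _ (\sum_(a <- monics K) (C ^ 2 * tau a ^ 2)%:R)).
    rewrite big_seq [X in _ <= X]big_seq; apply: ler_sum => a /hal ha.
    by rewrite -expnMn natrX lerXn2r ?nnegrE ?ler0n.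
  rewrite -natr_sum ler_nat -big_distrr leq_mul2l; apply/orP; right.
  exact: sum_tau_exp.
apply: (@le_trans _ _ (\sum_(b <- monics N) \sum_(b' <- monics N) D%:R ^+ 2 * ((tau b * tau b')%:R *
      `|\sum_(a <- monics K) w (b * a) * (w (b' * a))^*|))); last first.
  under eq_bigr do rewrite -mulr_sumr; rewrite -mulr_sumr natrM natrX.
  by rewrite ler_wpM2l ?exprn_ge0 ?ler0n // pair_sum_bound.
rewrite -[X in X <= _]ger0_norm; last by apply: sumr_ge0 => a _; rewrite exprn_ge0.
have -> : \sum_(a <- monics K) `|\sum_(b <- monics N) beta b * w (b * a)| ^+ 2 =
  \sum_(b <- monics N) \sum_(b' <- monics N) beta b * (beta b')^* *
     \sum_(a <- monics K) w (b * a) * (w (b' * a))^*.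
  under eq_bigr do rewrite normCK rmorph_sum big_distrlr /=.
  rewrite exchange_big /=; apply: eq_bigr => b _.
  rewrite exchange_big /=; apply: eq_bigr => b' _.
  rewrite mulr_sumr; apply: eq_bigr => a _.
  by rewrite rmorphM mulrACA.
apply: le_trans (ler_norm_sum _ _ _) _.
rewrite big_seq [X in _ <= X]big_seq; apply: ler_sum => b /hbe hb.
apply: le_trans (ler_norm_sum _ _ _) _.
rewrite big_seq [X in _ <= X]big_seq; apply: ler_sum => b' /hbe hb'.
rewrite !normrM norm_conjC mulrA; apply: ler_wpM2r => //.
have -> : D%:R ^+ 2 * (tau b * tau b')%:R = (D * tau b)%:R * (D * tau b')%:R :> algC.
  by rewrite !natrM expr2 mulrACA.
by apply: ler_pM.
Qed.

End ExponentialSums.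

(** * The exponential sum over irreducible polynomials *)

Section PrimeSum.
Variables (F : finFieldType) (m : nat) (c : 'I_m.+1 -> F) (psi : F -> algC).
Hypotheses (two_neq0 : (2 : F) != 0) (cm : c ord_max != 0).
Hypothesis psiP : additive_character psi.
Variables (n : nat) (ell : {poly F} -> F).
Hypothesis ellD : {morph ell : x y / x + y}.
Variable rho : nat.
Hypotheses (n_gt0 : (0 < n)%N) (rho_le : (10 * rho <= n)%N).
Local Notation q := #|F|.
Local Notation monics := (monics F).
Local Notation w := (fun f => psi (phase c n ell f)).
(** Exponent for squared sums: the trivial [2 * n] less the saving [rho], with a margin depending on
    [m] only. *)
Local Notation E := (2 * n - rho + 3 * m + 2)%N.

Let q1 : (1 < q)%N := finNzRing_gt1 F.

Lemma tau_gt0 (f : {poly F}) : f != 0 -> (0 < tau f)%N.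
Proof.
move=> f0; have : 1 \in mdivs f by rewrite mem_mdivs // monic1 dvd1p.
by rewrite /tau; case: (mdivs f).
Qed.

Lemma leq_expS a b e : (a <= b)%N -> (a.+1 ^ e <= b.+1 ^ e)%N.
Proof. by case: e => // e ab; rewrite leq_exp2r. Qed.

(** Up to powers of [n.+1], good pairs give [q ^ (2 * n - rho)], equal autocorrelations give
    [q ^ (2 * n - N)], which is where [rho <= N] enters, and nonzero bad symbols give at most
    [q ^ E]. *)
Lemma bilinear_bound N K (C D : nat) (alpha beta : {poly F} -> algC) :
    (N + K)%N = n -> (rho <= N <= K)%N ->
    (forall a, a \in monics K -> `|alpha a| <= (C * tau a)%:R) ->
    (forall b, b \in monics N -> `|beta b| <= (D * tau b)%:R) ->
  `|\sum_(b <- monics N) \sum_(a <- monics K) beta b * alpha a * w (b * a)| ^+ 2 <=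
  (2 * (C * D) ^ 2 * n.+1 ^ 11 * q ^ E)%:R.
Proof.
move=> NK /andP[rN NleK] hal hbe.
have rK : (rho.*2 <= K)%N by lia.
apply: le_trans (type2_bound two_neq0 cm psiP ellD NK rK hal hbe) _; rewrite ler_nat.
have := card_bad_symbols two_neq0 cm NleK rK; rewrite doubleK.
set bad := #|_| => hbad.
have bad_le : (q ^ K * q ^ K * q ^ N * bad <= n.+1 * q ^ E)%N.
  apply: leq_trans (leq_mul (leqnn _) hbad) _; rewrite mulnDr [X in (_ <= X)%N]mulSn.
  apply: leq_add; first by rewrite muln1 -!expnD leq_exp2l //; lia.
  (* Nonzero bad symbols need [K < N + m + 2 rho]. With [10 rho <= N + K] this yields
     [4 rho <= N + m], exactly what the exponents require. *)
  case: ltnP => h; rewrite ?mul0n ?muln0 // mul1n mulnCA -!expnD.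
  by apply: leq_mul; [lia | rewrite leq_exp2l //; lia].
have X_le : (q ^ K * (q ^ (K - rho) * (N.+1 * q ^ N) ^ 2) <= n.+1 ^ 2 * q ^ E)%N.
  rewrite expnMn (mulnCA (q ^ (K - rho))%N) mulnCA -expnM -!expnD; apply: leq_mul.
    by apply: leq_expS; lia.
  by rewrite leq_exp2l //; lia.
have Y_le : (q ^ K * (q ^ K * (bad * (N.+1 ^ 7 * q ^ N))) <= n.+1 ^ 8 * q ^ E)%N.
  have -> : (q ^ K * (q ^ K * (bad * (N.+1 ^ 7 * q ^ N))) =
             N.+1 ^ 7 * (q ^ K * q ^ K * q ^ N * bad))%N by ring.
  rewrite [X in (_ <= X)%N](_ : _ = n.+1 ^ 7 * (n.+1 * q ^ E))%N; last by rewrite mulnA -expnSr.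
  by apply: leq_mul => //; apply: leq_expS; lia.
set X := (q ^ (K - rho) * _)%N in X_le *; set Y := (q ^ K * (bad * _))%N in Y_le *.
have -> : (C ^ 2 * (K.+1 ^ 3 * q ^ K) * (D ^ 2 * (X + Y)) =
   (C * D) ^ 2 * (K.+1 ^ 3 * (q ^ K * X + q ^ K * Y)))%N by rewrite expnMn; ring.
have -> : (2 * (C * D) ^ 2 * n.+1 ^ 11 * q ^ E =
   (C * D) ^ 2 * (n.+1 ^ 3 * (n.+1 ^ 8 * q ^ E + n.+1 ^ 8 * q ^ E)))%N.
  by rewrite (expnD _ 3 8); ring.
apply: leq_mul => //; apply: leq_mul; first by apply: leq_expS; lia.
apply: leq_add => //; apply: leq_trans X_le _.
by rewrite leq_mul2r leq_exp2l // orbT.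
Qed.

(** Two more powers of [n.+1] than in [bilinear_bound], to cover [C * D = n]. *)
Local Notation B := (2 * n.+1 ^ 13 * q ^ E)%N.

Lemma mangoldt_bound k e : (k <= n)%N -> e \in monics k ->
  (mangoldt n e <= n)%N.
Proof.
move=> kn me; apply: leq_trans (mangoldt_le (monics_monic me) _) _.
  by rewrite (monics_size me) ltnS.
by rewrite (monics_size me).
Qed.

(** In type I sums up to two variables of degree at most [rho] are summed trivially, which costs
    [q ^ (4 * rho)] after squaring. *)
Lemma type1_le_bound : (n.+1 ^ 4 * (q ^ (4 * rho) * q ^ (n + m)) <= B)%N.
Proof.
rewrite -expnD; apply: leq_mul; last by rewrite leq_exp2l //; lia.
rewrite -[X in (X <= _)%N]mul1n; apply: leq_mul => //.
by rewrite leq_exp2l.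
Qed.

(** Expanding [trunc_moebius] writes [h] as [d * g]; with [e * d], of degree at most [2 rho], as
    outer variable, the sum over [g] is free. *)
Lemma vaughan_term_type1 k : (k <= rho)%N ->
  `|vaughan_term n rho w k| ^+ 2 <= B%:R.
Proof.
move=> kr; have kn : (k <= n)%N by lia.
have -> : vaughan_term n rho w k = \sum_(e <- monics k) \sum_(j < rho.+1)
   \sum_(d <- monics j) (mangoldt n e)%:R * moebius n d *
     \sum_(g <- monics (n - k - j)) w (e * d * g).
  apply: eq_bigr => e _.
  transitivity (\sum_(h <- monics (n - k)) \sum_(j < rho.+1)
      \sum_(d <- monics j | d %| h) (mangoldt n e)%:R * moebius n d * w (e * (d * (h %/ d)))).
    apply: eq_bigr => h _; rewrite /trunc_moebius mulr_sumr mulr_suml.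
    apply: eq_bigr => j _; rewrite mulr_sumr mulr_suml; apply: eq_bigr => d dh.
    by rewrite [d * _]mulrC divpK.
  rewrite exchange_big; apply: eq_bigr => j _.
  have jn : (j <= n - k)%N by have := ltn_ord j; lia.
  rewrite (big_monics_conv _ (fun d g => (mangoldt n e)%:R * moebius n d * w (e * (d * g))) jn).
  by apply: eq_bigr => d _; rewrite mulr_sumr; apply: eq_bigr => g _; rewrite mulrA.
pose Z := (n ^ 2 * q ^ (n + m))%N.
apply: (@le_trans _ _ ((q ^ k)%:R ^+ 2 * (rho.+1%:R ^+ 2 * ((q ^ rho)%:R ^+ 2 * Z%:R)))).
  rewrite -[X in X%:R ^+ 2 * _](size_monics F k); apply: norm_sum_sqr => e me.
  apply: norm_sum_sqr_ord => j; have jr := ltn_ord j.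
  apply: (@le_trans _ _ ((q ^ j)%:R ^+ 2 * Z%:R)); last first.
    rewrite ler_wpM2r ?ler0n // lerXn2r ?nnegrE ?ler0n // ler_nat leq_exp2l //.
  rewrite -[X in X%:R ^+ 2 * _](size_monics F j); apply: norm_sum_sqr => d md.
  rewrite normrM exprMn natrM; apply: ler_pM; rewrite ?exprn_ge0 //.
    rewrite natrX lerXn2r ?nnegrE ?ler0n // normrM normr_nat.
    rewrite -[X in _ <= X]mulr1; apply: ler_pM => //; last exact: norm_moebius.
    by rewrite ler_nat (mangoldt_bound kn).
  apply: (@type1_bound _ _ _ _ two_neq0 cm psiP _ _ ellD (k + j)); first lia.
  exact: monicsM.
rewrite -!natrX -!natrM ler_nat; apply: leq_trans type1_le_bound.
rewrite [X in (X <= _)%N](_ : _ = (rho.+1 * n) ^ 2 * (q ^ k * q ^ rho) ^ 2 * q ^ (n + m))%N; last first.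
  by rewrite /Z !expnMn; ring.
rewrite mulnA leq_mul2r; apply/orP; right; apply: leq_mul.
  by rewrite (expnM _ 2 2) leq_exp2r // -mulnn leq_mul //; lia.
by rewrite -expnD -expnM leq_exp2l //; lia.
Qed.

(** Small [k] is type I; for [n - k <= rho] the factor [trunc_moebius] vanishes; in between the sum
    is bilinear, and the shorter of [e] and [h] plays the role of [b]. *)
Lemma vaughan_term_bound k : (k < n)%N -> `|vaughan_term n rho w k| ^+ 2 <= B%:R.
Proof.
move=> kn; have [|rk] := leqP k rho; first exact: vaughan_term_type1.
have [nr|kr] := leqP (n - k) rho.
  rewrite /vaughan_term big1 ?normr0 ?expr0n ?ler0n // => e _.
  rewrite big_seq big1 // => h mh.
  by rewrite (trunc_moebius0 mh) ?mulr0 ?mul0r ?nr ?subn_gt0 ?leq_subr ?andbT.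
have hH h : h \in monics (n - k) -> `|trunc_moebius n rho h| <= (1 * tau h)%:R.
  by move=> mh; rewrite mul1n (norm_trunc_moebius _ _ mh).
have hL e : e \in monics k -> `|(mangoldt n e)%:R : algC| <= (n * tau e)%:R.
  move=> me; rewrite normr_nat ler_nat.
  apply: leq_trans (mangoldt_bound (ltnW kn) me) _.
  by rewrite leq_pmulr // tau_gt0 // (monics_neq0 me).
have fin C D : (C * D)%N = n -> (2 * (C * D) ^ 2 * n.+1 ^ 11 * q ^ E <= B)%N.
  move=> ->; rewrite leq_mul2r; apply/orP; right; rewrite -mulnA leq_mul2l /=.
  by rewrite (expnD _ 2 11) leq_mul2r leq_exp2r // leqnSn orbT.
have [knk|knk] := leqP k (n - k).
  apply: le_trans (bilinear_bound (N := k) (K := n - k) _ _ hH hL) _.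
  - by rewrite subnKC // ltnW.
  - by rewrite knk ltnW.
  by rewrite ler_nat fin // mul1n.
rewrite /vaughan_term exchange_big /=.
under eq_bigr => h _ do under eq_bigr => e _ do rewrite [_%:R * _]mulrC [e * h]mulrC.
apply: le_trans (bilinear_bound (N := n - k) (K := k) _ _ hL hH) _.
- by rewrite subnK // ltnW.
- by rewrite (ltnW kr) (ltnW knk).
by rewrite ler_nat fin // muln1.
Qed.

(** [mangoldt] equals [n] on the irreducibles of degree [n], so [n] times the sum is the weighted
    sum over all monics less its reducible part; [n >= 1] lets the factor be dropped. *)
Lemma prime_sum_bound :
  `|\sum_(f <- monics n | irreducibleb f) w f| ^+ 2 <= (12 * n.+1 ^ 15 * q ^ E)%:R.
Proof.
have rn : (rho < n)%N by lia.
have T_le : `|\sum_(f <- monics n) (mangoldt n f)%:R * w f| ^+ 2 <=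
    2 * (B%:R + n%:R ^+ 2 * B%:R).
  rewrite (vaughan_identity w rn); apply: norm_sub_sqr; last first.
    by apply: norm_sum_sqr_ord => k; apply: vaughan_term_bound.
  pose Z := (n ^ 2 * q ^ (n + m))%N.
  apply: (@le_trans _ _ (rho.+1%:R ^+ 2 * ((q ^ rho)%:R ^+ 2 * Z%:R))).
    apply: norm_sum_sqr_ord => j; have jr := ltn_ord j.
    apply: (@le_trans _ _ ((q ^ j)%:R ^+ 2 * Z%:R)); last first.
      by rewrite ler_wpM2r ?ler0n // lerXn2r ?nnegrE ?ler0n // ler_nat leq_exp2l.
    rewrite -[X in X%:R ^+ 2 * _](size_monics F j); apply: norm_sum_sqr => d md.
    rewrite -mulr_sumr normrM exprMn natrM; apply: ler_pM; rewrite ?exprn_ge0 //.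
      rewrite natrX lerXn2r ?nnegrE ?ler0n // normrM normr_nat.
      rewrite -[X in _ <= X]mul1r; apply: ler_pM => //; first exact: norm_moebius.
      by rewrite ler_nat leq_subr.
    apply: (@type1_bound _ _ _ _ two_neq0 cm psiP _ _ ellD j) => //; lia.
  rewrite -!natrX -!natrM ler_nat; apply: leq_trans type1_le_bound.
  rewrite [X in (X <= _)%N](_ : _ = (rho.+1 * n) ^ 2 * (q ^ rho) ^ 2 * q ^ (n + m))%N; last first.
    by rewrite /Z !expnMn; ring.
  rewrite mulnA leq_mul2r; apply/orP; right; apply: leq_mul.
    by rewrite (expnM _ 2 2) leq_exp2r // -mulnn leq_mul //; lia.
  by rewrite -expnM leq_exp2l //; lia.
have P_le : `|\sum_(f <- monics n | ~~ irreducibleb f) (mangoldt n f)%:R * w f| ^+ 2 <= B%:R.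
  apply: (@le_trans _ _ ((n.+1 ^ 3 * q ^ n./2)%:R ^+ 2)).
    rewrite lerXn2r ?nnegrE ?ler0n //.
    apply: le_trans (ler_norm_sum _ _ _) _.
    under eq_bigr do rewrite normrM norm_psi // mulr1 normr_nat.
    by rewrite -natr_sum ler_nat sum_mangoldt_reducible.
  rewrite -natrX ler_nat expnMn -!expnM; apply: leq_mul; last by rewrite leq_exp2l //; lia.
  rewrite -[X in (X <= _)%N]mul1n; apply: leq_mul => //.
  by rewrite leq_exp2l.
have nS : n%:R * \sum_(f <- monics n | irreducibleb f) w f =
   \sum_(f <- monics n) (mangoldt n f)%:R * w f -
   \sum_(f <- monics n | ~~ irreducibleb f) (mangoldt n f)%:R * w f.
  rewrite [X in _ = X - _](bigID (@irreducibleb F)) /= addrK mulr_sumr.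
  rewrite big_seq_cond [RHS]big_seq_cond; apply: eq_bigr => f /andP[mf /irreducibleP irf].
  by rewrite mangoldt_irreducible.
have := norm_sub_sqr T_le P_le; rewrite -nS => h.
apply: (@le_trans _ _ (`|n%:R * \sum_(f <- monics n | irreducibleb f) w f| ^+ 2)).
  rewrite lerXn2r ?nnegrE ?normr_ge0 // normrM normr_nat ler_peMl //.
  by rewrite ler1n.
apply: le_trans h _.
rewrite -natrX -!(natrM, natrD) ler_nat.
rewrite [X in (_ <= X)%N](_ : _ = 6 * n.+1 ^ 2 * B)%N; last first.
  by rewrite (expnD _ 2 13); ring.
rewrite [X in (X <= _)%N](_ : _ = (2 * (2 * (1 + n ^ 2) + 1)) * B)%N; last by ring.
by rewrite leq_mul2r; apply/orP; right; rewrite -!mulnn; lia.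
Qed.

End PrimeSum.

(** * From exponential sums to the count *)

Section Counting.
Variables (F : finFieldType) (m : nat) (c : 'I_m.+1 -> F).
Hypotheses (oddF : odd #|F|) (cm : c ord_max != 0).
Local Notation q := #|F|.
Local Notation monics := (monics F).

(** Otherwise 1 would have additive order 2, which would divide the odd order of the group. *)
Lemma odd_card_two_neq0 : (2 : F) != 0.
Proof.
apply/negP => /eqP two0; have /order_dvdG : (1 : F) \in [set: F]%G by rewrite inE.
suff -> : #[(1 : F)%R]%g = 2%N by rewrite cardsT dvdn2 oddF.
apply: nt_prime_order => //; exact: oner_neq0.
Qed.

Lemma big_mkpoly (V : nmodType) n (P : pred {poly F}) (G : {poly F} -> V) :
  \sum_(g : {ffun 'I_n -> F} | P (mkpoly g)) G (mkpoly g) =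
  \sum_(f <- monics n | P f) G f.
Proof.
rewrite [RHS]big_mkcond big_monics [LHS]big_mkcond /=.
rewrite (reindex (fun v : 'rV[F]_n => [ffun i => v 0 i])) /=; last first.
  exists (fun g : {ffun 'I_n -> F} => \row_i g i) => [v _|g _].
    by apply/rowP => i; rewrite mxE ffunE.
  by apply/ffunP => i; rewrite ffunE mxE.
apply: eq_bigr => v _; suff -> : mkpoly [ffun i => v 0 i] = 'X^n + rVpoly v by [].
rewrite /mkpoly [rVpoly v](@poly_sumXn _ n) ?size_poly //; congr (_ + _).
by apply: eq_bigr => i _; rewrite ffunE mul_polyC coef_rVpoly_ord.
Qed.

Definition linear_form n (a : 'I_n.+1 -> F) (f : {poly F}) := \sum_(i < n.+1) a i * f`_i.

Lemma linear_formD n (a : 'I_n.+1 -> F) : {morph linear_form a : f g / f + g}.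
Proof.
by move=> f g; rewrite -big_split; apply: eq_bigr => i _; rewrite coefD mulrDr.
Qed.

Lemma QA_phase n (a : 'I_n.+1 -> F) f : f \in monics n ->
  QA c a f = phase c n (linear_form a) f.
Proof.
move=> mf; rewrite /QA /phase -symbol_quadratic ?(monics_size mf) //.
by rewrite mulKf ?odd_card_two_neq0.
Qed.

(** Orthogonality over all [l] detects the value [gamma]; the frequency [l = 0] contributes
    [numP F n]. *)
Lemma countQ_fourier psi n (a : 'I_n.+1 -> F) gamma : additive_character psi ->
  (q * countQ c a gamma)%:R - (numP F n)%:R =
  \sum_(l : F | l != 0) psi (- (l * gamma)) *
     \sum_(f <- monics n | irreducibleb f) psi (l * phase c n (linear_form a) f).
Proof.
move=> psiP.
have irrE (f : {poly F}) : `[< irreducible_poly f >] = irreducibleb f.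
  by apply/asboolP/irreducibleP.
have -> : (q * countQ c a gamma)%:R = \sum_(l : F) psi (- (l * gamma)) *
     \sum_(f <- monics n | irreducibleb f) psi (l * phase c n (linear_form a) f).
  rewrite /countQ -sum1dep_card.
  under eq_bigl do rewrite irrE.
  rewrite (big_mkpoly n (fun f => irreducibleb f && (QA c a f == gamma)) (fun=> 1%N)).
  rewrite natrM natr_sum mulr_sumr big_mkcondr.
  under [RHS]eq_bigr do rewrite mulr_sumr.
  rewrite [RHS]exchange_big /= big_seq_cond [RHS]big_seq_cond.
  apply: eq_bigr => f /andP[mf _].
  under eq_bigr do rewrite -psiD // addrC -mulrBr.
  rewrite sum_psi_scale // subr_eq0 QA_phase //.
  by case: eqP => _; rewrite ?muln1 ?muln0 ?mulr1.
rewrite (bigD1 0) //= mul0r oppr0 psi0 // mul1r.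
suff -> : (numP F n)%:R = \sum_(f <- monics n | irreducibleb f) psi (0 * phase c n (linear_form a) f).
  by rewrite addrAC subrr add0r.
rewrite /numP -sum1dep_card; under eq_bigl do rewrite irrE.
rewrite (big_mkpoly n (@irreducibleb F) (fun=> 1%N)) natr_sum.
by apply: eq_bigr => f _; rewrite mul0r psi0.
Qed.

(** Bounding both truncated subtractions, one of which is 0, expresses an absolute value in natural
    numbers, which carries the bound from [algC] to the reals. *)
Lemma countQ_deviation n (a : 'I_n.+1 -> F) gamma : (0 < n)%N ->
  let M := (q ^ 2 * (12 * n.+1 ^ 15 * q ^ (2 * n - n %/ 10 + 3 * m + 2)))%N in
  ((q * countQ c a gamma - numP F n) ^ 2 <= M /\
   (numP F n - q * countQ c a gamma) ^ 2 <= M)%N.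
Proof.
move=> n0 M; have [psi psiP] := additive_character_exists F.
have h : `|(q * countQ c a gamma)%:R - (numP F n)%:R : algC| ^+ 2 <= M%:R.
  rewrite (countQ_fourier _ _ psiP) -big_filter.
  set W := (12 * _ * _)%N in M *.
  apply: le_trans (norm_sum_sqr (Z := W%:R) _) _ => [l|].
    rewrite mem_filter => /andP[l0 _]; rewrite normrM norm_psi // mul1r.
    (* Matching the exponent in [W] sets [rho] to [n %/ 10]. *)
    apply: (prime_sum_bound odd_card_two_neq0 cm (additive_character_scale psiP l0)) => //.
      exact: linear_formD.
    by rewrite mulnC leq_trunc_div.
  rewrite -natrX -natrM ler_nat leq_mul2r; apply/orP; right.
  rewrite leq_exp2r // size_filter (leq_trans (count_size _ _)) //.
  by rewrite -sum1_size sum_nat_const muln1.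
have [le|/ltnW le] := leqP (numP F n) (q * countQ c a gamma).
  move: h; rewrite -natrB // normr_nat -natrX ler_nat => h; split=> //.
  by move: le; rewrite -subn_eq0 => /eqP ->.
move: h; rewrite distrC -natrB // normr_nat -natrX ler_nat => h; split=> //.
by move: le; rewrite -subn_eq0 => /eqP ->.
Qed.

End Counting.

(* Real estimates and the asymptotic statement *)
From Stdlib Require Import Reals Lra.
Delimit Scope nat_scope with N.
Local Notation "m ^ n" := (expn m n) : nat_scope.
Open Scope R_scope.

Lemma INR_muln a b : INR (muln a b) = INR a * INR b.
Proof. exact: mult_INR. Qed.

Lemma INR_expn a b : INR (expn a b) = INR a ^ b.
Proof. by elim: b => [|b IH] //; rewrite expnS INR_muln IH. Qed.

Lemma INR_leq a b : leq a b -> INR a <= INR b.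
Proof. by move/ssrnat.leP; apply: le_INR. Qed.

Lemma pow_exp_ln x k : 0 < x -> x ^ k = exp (INR k * ln x).
Proof. by move=> x0; rewrite -Rpower_pow. Qed.

Lemma sqr_INR_sub_le x y M : leq (expn (subn x y) 2) M -> leq (expn (subn y x) 2) M ->
  (INR x - INR y) ^ 2 <= INR M.
Proof.
move=> h1 h2; have [le|/ltnW le] := leqP y x.
  by rewrite -minus_INR; [rewrite -INR_expn; apply: INR_leq | apply/ssrnat.leP].
have -> : (INR x - INR y) ^ 2 = (INR y - INR x) ^ 2 by ring.
by rewrite -minus_INR; [rewrite -INR_expn; apply: INR_leq | apply/ssrnat.leP].
Qed.

Lemma sqr_le_le x y : 0 <= y -> x ^ 2 <= y ^ 2 -> Rabs x <= y.
Proof.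
move=> y0 h; rewrite -(Rabs_pos_eq y) //; apply: Rsqr_le_abs_0.
by rewrite !Rsqr_pow2.
Qed.

Lemma exp_le_compat x y : x <= y -> exp x <= exp y.
Proof. by case=> [/exp_increasing/Rlt_le|->] //; apply: Rle_refl. Qed.

(** With [y = ln (n + 1)], the square of the logarithm is at most linear in [n]. *)
Lemma ln_sqr_le y : 0 <= y -> y ^ 2 <= 4 * exp y.
Proof.
move=> y0; have h := exp_ineq1_le (y / 2).
have -> : exp y = exp (y / 2) * exp (y / 2) by rewrite -exp_plus; congr exp; field.
nra.
Qed.

(** With [l = ln q] and [n > 0], [q] to the power [log_error l n * n] is [(n + 1)^8], enough to
    absorb the square root of [(n + 1)^15]. *)
Definition log_error (l : R) (n : nat) := 8 * ln (INR n.+1) / (INR n * l).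

Lemma log_error_cvg0 l : 0 < l ->
  forall e : R, 0 < e -> exists N : nat, forall n : nat, is_true (leq N n) ->
    Rabs (log_error l n) < e.
Proof.
(* For [n > 1], [(8 ln (n + 1))^2 <= 256 (n + 1) < 512 n], so [512 < n l^2 e^2] suffices; the added
   1 ensures [n > 1]. *)
move=> l0 e e0; have [N hN] := INR_unbounded (512 / (l ^ 2 * e ^ 2) + 1).
exists N => n /INR_leq Nn.
have le0 : 0 < l ^ 2 * e ^ 2 by apply: Rmult_lt_0_compat; apply: pow_lt.
have quo0 : 0 < 512 / (l ^ 2 * e ^ 2) by apply: Rdiv_lt_0_compat; lra.
have n1 : 1 < INR n by lra.
have hn : 512 < INR n * (l ^ 2 * e ^ 2).
  have : 512 / (l ^ 2 * e ^ 2) < INR n by lra.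
  by move/(Rmult_lt_compat_r _ _ _ le0); rewrite /Rdiv Rmult_assoc Rinv_l ?Rmult_1_r //; lra.
have Sn : INR n.+1 = INR n + 1 by rewrite S_INR.
have L0 : 0 <= ln (INR n.+1) by rewrite -ln_1; apply: Rlt_le; apply: ln_increasing; lra.
have := ln_sqr_le L0; rewrite exp_ln; last lra.
rewrite /log_error; set L := ln _ in L0 * => hL.
have nl0 : 0 < INR n * l by nra.
rewrite Rabs_pos_eq; last by apply: Rmult_le_pos; [lra | apply: Rlt_le; apply: Rinv_0_lt_compat].
apply: (Rmult_lt_reg_r (INR n * l)) => //.
have -> : 8 * L / (INR n * l) * (INR n * l) = 8 * L by field; lra.
have L2 : (8 * L) ^ 2 < (e * (INR n * l)) ^ 2.
  have : INR n * 512 < INR n * (INR n * (l ^ 2 * e ^ 2)) by apply: Rmult_lt_compat_l; lra.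
  nra.
have e1 : 0 < e * (INR n * l) by nra.
nra.
Qed.

(** Divide by [q] and take square roots: half of [2 n - n / 10] is [19 n / 20] up to rounding,
    [(n + 1)^15] goes into [log_error], and the rest into a generous constant, with 12 in place of
    its square root and [3 m + 3] in place of its half. *)
Lemma deviation_bound (q m n x y : nat) : leq 2 q -> leq 1 n ->
    ((q * x - y) ^ 2 <=
      q ^ 2 * (12 * n.+1 ^ 15 * q ^ (2 * n - n %/ 10 + 3 * m + 2)))%N ->
    ((y - q * x) ^ 2 <=
      q ^ 2 * (12 * n.+1 ^ 15 * q ^ (2 * n - n %/ 10 + 3 * m + 2)))%N ->
  Rabs (INR x - INR y / INR q) <=
  12 * exp ((3 * INR m + 3) * ln (INR q)) *
  Rpower (INR q) (19 * INR n / 20 + log_error (ln (INR q)) n * INR n).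
Proof.
move=> q2 n1 h1 h2; have := sqr_INR_sub_le h1 h2.
rewrite !(INR_muln, INR_expn).
have q2' : 2 <= INR q by apply: (INR_leq q2).
have n1' : 1 <= INR n by apply: (INR_leq n1).
have Sn : INR n.+1 = INR n + 1 by rewrite S_INR.
have l0 : 0 < ln (INR q) by rewrite -ln_1; apply: ln_increasing; lra.
have L0 : 0 <= ln (INR n.+1) by rewrite -ln_1; apply: Rlt_le; apply: ln_increasing; lra.
have -> : INR q * INR x - INR y = INR q * (INR x - INR y / INR q) by field; lra.
set t := INR x - _ => ht.
have {ht} : t ^ 2 <= 12 * INR n.+1 ^ 15 * INR q ^ (2 * n - n %/ 10 + 3 * m + 2)%N.
  apply: (Rmult_le_reg_l (INR q ^ 2)); first nra.
  rewrite Rpow_mult_distr in ht; apply: (Rle_trans _ _ _ ht).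
  by apply: Req_le; congr (_ * (_ * _ * _)); rewrite /=; lra.
rewrite (@pow_exp_ln (INR n.+1)) ?(@pow_exp_ln (INR q)); try lra.
set l := ln (INR q) in l0 *; set L := ln (INR n.+1) in L0 *.
rewrite /Rpower -/l /log_error -/L => ht.
apply: sqr_le_le; first by have := exp_pos; move=> ep; apply: Rmult_le_pos; [apply: Rmult_le_pos; [lra|]|]; apply: Rlt_le.
apply: (Rle_trans _ _ _ ht).
have -> : (12 * exp ((3 * INR m + 3) * l) *
   exp ((19 * INR n / 20 + 8 * L / (INR n * l) * INR n) * l)) ^ 2 =
   144 * exp (2 * (3 * INR m + 3) * l + 19 * INR n / 10 * l + 16 * L).
  have -> : 2 * (3 * INR m + 3) * l + 19 * INR n / 10 * l + 16 * L =
    ((3 * INR m + 3) * l + (19 * INR n / 20 + 8 * L / (INR n * l) * INR n) * l) +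
    ((3 * INR m + 3) * l + (19 * INR n / 20 + 8 * L / (INR n * l) * INR n) * l) by field; lra.
  by rewrite !exp_plus; ring.
rewrite Rmult_assoc -exp_plus.
have m0 := pos_INR m.
(* Rounding in [n %/ 10] costs less than 1, which turns 2 into 3. *)
have hE : INR (2 * n - n %/ 10 + 3 * m + 2)%N <= 19 * INR n / 10 + 3 * INR m + 3.
  have : (10 * (2 * n - n %/ 10 + 3 * m + 2) <= 19 * n + 30 * m + 30)%N by lia.
  move/INR_leq; rewrite !(INR_muln, plus_INR); rewrite /=; lra.
have he : exp (INR 15 * L + INR (2 * n - n %/ 10 + 3 * m + 2)%N * l) <=
   exp (2 * (3 * INR m + 3) * l + 19 * INR n / 10 * l + 16 * L).
  apply: exp_le_compat; rewrite /=; nra.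
have := exp_pos (INR 15 * L + INR (2 * n - n %/ 10 + 3 * m + 2)%N * l).
lra.
Qed.

Theorem theorem1p1 (F : finFieldType) (m : nat) (c : 'I_m.+1 -> F) :
  odd #|F| -> c ord_max != GRing.zero ->
  exists (eps : nat -> R) (C : R),
    (forall e : R, 0 < e -> exists N : nat, forall n : nat, is_true (leq N n) -> Rabs (eps n) < e) /\
    exists N0 : nat, forall n : nat, is_true (leq N0 n) ->
      forall (a : 'I_n.+1 -> F) (gamma : F),
        Rabs (INR (countQ c a gamma) - INR (numP F n) / INR #|F|)
          <= C * Rpower (INR #|F|) (19 * INR n / 20 + eps n * INR n).
Proof.
move=> oddF cm; have q1 := finNzRing_gt1 F.
have q2 : 2 <= INR #|F| by apply: (INR_leq q1).
exists (log_error (ln (INR #|F|))), (12 * exp ((3 * INR m + 3) * ln (INR #|F|))); split.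
  by apply: log_error_cvg0; rewrite -ln_1; apply: ln_increasing; lra.
exists 1%nat => n n1 a gamma.
have [h1 h2] := countQ_deviation oddF cm a gamma n1.
exact: deviation_bound.
Qed.
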